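(* Let $\mathcal I$ be an index set. For each $k\in\mathcal I$ and $n\in\mathbb N$, let $1\le r_{k,n}\le n$ be an integer and let $$H_{k,n}=\frac{(\sqrt{-1})^{\lfloor r_{k,n}/2\rfloor}}{\binom{n}{r_{k,n}}^{1/2}}\sum_{1\le i_1<\cdots<i_{r_{k,n}}\le n}J_{k;i_1,\dots,i_{r_{k,n}}}\,\psi_{i_1}\cdots\psi_{i_{r_{k,n}}},$$ where the $J_{k;i_1,\dots,i_{r_{k,n}}}$ are independent (real) random variables with $\mathbb E[J_{k;i_1,\dots,i_{r_{k,n}}}]=0$, $\mathbb E[J_{k;i_1,\dots,i_{r_{k,n}}}^2]=1$, and such that for each integer $p\ge 3$ there is a constant $C_p<\infty$ with $|\mathbb E[J_{k;i_1,\dots,i_{r_{k,n}}}^p]|\le C_p$ (for all of these variables), and where the $\psi_i$ are Majorana fermions satisfying the canonical anticommutation relations $\psi_i\psi_j+\psi_j\psi_i=2\delta_{i,j}$. Assume that for each $k\in\mathcal I$ the integers $r_{k,n}$, $n\in\mathbb N$, all have the same parity, and that for all $i,j\in\mathcal I$ $$\lim_{n\to\infty}\frac{r_{i,n}}{n}=0,\qquad \lim_{n\to\infty}\frac{r_{i,n}r_{j,n}}{n}=\lambda_{i,j}\in[0,\infty].$$ Then for all $d\in\mathbb N$ and all $k_1,\dots,k_d\in\mathcal I$, $$\lim_{n\to\infty}\mathbb E\left[\operatorname{tr}\left(H_{k_1,n}\cdots H_{k_d,n}\right)\right]=\tau_{\mathcal H}(s_{k_1}\cdots s_{k_d}),$$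 where $\{s_i\mid i\in\mathcal I\}$ is a $Q=(q_{i,j})$-system (mixed $q$-Gaussian system) with $q_{i,j}=(-1)^{r_{i,n}r_{j,n}}e^{-2\lambda_{i,j}}$.
   Context: $\mathbb N=\{1,2,\dots\}$ and $e^{-\infty}=0$. The sign $(-1)^{r_{i,n}r_{j,n}}$ does not depend on $n$ by the parity assumption. Majorana fermions are self-adjoint elements $\psi_1,\psi_2,\dots$ of a unital $*$-algebra with $\psi_i\psi_j+\psi_j\psi_i=2\delta_{i,j}$; $\operatorname{tr}$ is the normalized trace on the algebra they generate (so $\operatorname{tr}(1)=1$ and $\operatorname{tr}(\psi_{i_1}\cdots\psi_{i_r})=0$ for $i_1<\cdots<i_r$, $r\ge1$). For each $n$, independence is over all $k\in\mathcal I$ and all index tuples. Mixed $q$-Gaussian system: let $Q=(q_{i,j})_{i,j\in\mathcal I}$ be a real symmetric matrix with $|q_{i,j}|\le1$, let $\mathcal H$ be a Hilbert space with orthonormal basis $\{e_i\mid i\in\mathcal I\}$, and let $\mathcal F_{\mathrm{alg}}(\mathcal H)$ be the algebraic full Fock space spanned by the vacuum $\Omega$ and the tensors $e_{j_1}\otimes\cdots\otimes e_{j_n}$, $n\ge1$. It carries the positive semidefinite form $\langle\cdot,\cdot\rangle_Q$ for which $\Omega$ is a unit vector, tensors of different lengths are orthogonal, and $$\langle e_{i_1}\otimes\cdots\otimes e_{i_n},e_{j_1}\otimes\cdots\otimes e_{j_n}\rangle_Q=\sum_{k=1}^n\delta_{i_1,j_k}q_{i_1,j_1}\cdots q_{i_1,j_{k-1}}\langle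 e_{i_2}\otimes\cdots\otimes e_{i_n},e_{j_1}\otimes\cdots\otimes e_{j_{k-1}}\otimes e_{j_{k+1}}\otimes\cdots\otimes e_{j_n}\rangle_Q .$$ The left creation and annihilation operators are $l_i\Omega=e_i$, $l_i(e_{j_1}\otimes\cdots\otimes e_{j_n})=e_i\otimes e_{j_1}\otimes\cdots\otimes e_{j_n}$; $l_i^*\Omega=0$, $l_i^*(e_{j_1}\otimes\cdots\otimes e_{j_n})=\sum_{k=1}^n\delta_{i,j_k}q_{i,j_1}\cdots q_{i,j_{k-1}}e_{j_1}\otimes\cdots\otimes e_{j_{k-1}}\otimes e_{j_{k+1}}\otimes\cdots\otimes e_{j_n}$. Put $s_i=l_i+l_i^*$ and $\tau_{\mathcal H}(a)=\langle a\Omega,\Omega\rangle_Q$. The family $\{s_i\}$ with $\tau_{\mathcal H}$ is the $Q$-system. *)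

(* Defs.v *)
From HB Require Import structures.
From mathcomp Require Import all_boot all_order all_algebra.
From mathcomp Require Import all_classical all_reals all_analysis.
From mathcomp Require Import complex.
From mathcomp Require finmap monalg.
(* The notations of finmap and monalg clash with those of mathcomp-analysis. *)
Import (canonicals, coercions) finmap monalg.

Set Implicit Arguments.
Unset Strict Implicit.
Unset Printing Implicit Defensive.

Import Order.TTheory GRing.Theory Num.Theory.
Import numFieldNormedType.Exports.

Local Open Scope classical_set_scope.
Local Open Scope complex_scope.
Local Open Scope ring_scope.

Record is_star (R : realType) (A : algType R[i]) (star : A -> A) : Prop := {
  starK : forall a, star (star a) = a;
  starD : forall a b, star (a + b) = star a + star b;
  starZ : forall (c : R[i]) a, star (c *: a) = c^* *: star a;
  starM : forall a b, star (a * b) = star b * star a }.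

(* psi is indexed from 0: psi j is the (j+1)-st Majorana fermion. *)
Record is_majorana (R : realType) (A : algType R[i]) (star : A -> A)
    (psi : nat -> A) : Prop := {
  majorana_star : forall j, star (psi j) = psi j;
  majorana_car : forall j k,
    psi j * psi k + psi k * psi j = ((j == k)%:R *+ 2)%:A }.

(* The unital subalgebra generated by the psi j; it is star-closed when the
   psi j are self-adjoint. *)
Inductive gen_alg (R : realType) (A : algType R[i]) (psi : nat -> A) :
    A -> Prop :=
| gen_alg_psi j : gen_alg psi (psi j)
| gen_alg1 : gen_alg psi 1
| gen_algD a b : gen_alg psi a -> gen_alg psi b -> gen_alg psi (a + b)
| gen_algM a b : gen_alg psi a -> gen_alg psi b -> gen_alg psi (a * b)
| gen_algZ c a : gen_alg psi a -> gen_alg psi (c *: a).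

(* tr is only constrained on the generated algebra; its values elsewhere are
   irrelevant. *)
Record is_normalized_trace (R : realType) (A : algType R[i]) (psi : nat -> A)
    (tr : A -> R[i]) : Prop := {
  trace_linear : forall (c : R[i]) a b, gen_alg psi a -> gen_alg psi b ->
    tr (c *: a + b) = c * tr a + tr b;
  trace_cyclic : forall a b, gen_alg psi a -> gen_alg psi b ->
    tr (a * b) = tr (b * a);
  trace1 : tr 1 = 1;
  trace_psi : forall s : seq nat, sorted ltn s -> s != [::] ->
    tr (\prod_(j <- s) psi j) = 0 }.

(* Index tuples i_1 < ... < i_r are encoded as the r-element subsets S of 'I_n;
   enum S lists S in increasing order. *)
Definition syk (R : realType) (A : algType R[i]) (psi : nat -> A) (n r : nat)
    (J : {set 'I_n} -> R) : A :=
  ('i ^+ (r %/ 2) / (Num.sqrt ('C(n, r)%:R : R))%:C) *: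
    \sum_(S : {set 'I_n} | #|S| == r) (J S)%:C *: \prod_(j <- enum S) psi j.

(* Mutual independence of the variables X i, for i in D. *)
Definition mutually_independent d (T : measurableType d) (R : realType)
    (P : probability T R) (K : eqType) (D : set K) (X : K -> T -> R) : Prop :=
  forall (s : seq K) (B : K -> set R), uniq s -> [set` s] `<=` D ->
    (forall i, measurable (B i)) ->
    P (\bigcap_(i in [set` s]) (X i @^-1` B i)) =
      (\prod_(i <- s) P (X i @^-1` B i))%E.

Definition complex_integrable d (T : measurableType d) (R : realType)
    (P : probability T R) (X : T -> R[i]) : Prop :=
  P.-integrable setT (fun w => (complex.Re (X w))%:E) /\
  P.-integrable setT (fun w => (complex.Im (X w))%:E).

(* Meaningful for integrable X only, because of fine. *)
Definition complex_expectation d (T : measurableType d) (R : realType)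
    (P : probability T R) (X : T -> R[i]) : R[i] :=
  fine ('E_P[fun w => complex.Re (X w)]) +i*
  fine ('E_P[fun w => complex.Im (X w)]).

(* The basis vector attached to the word [:: j_1; ...; j_n] is
   e_{j_1} (x) ... (x) e_{j_n}; the empty word gives the vacuum. *)
Notation fock R I := (monalg.malg (seq I) R[i]).

Definition fock_word (R : realType) (I : choiceType) (w : seq I) : fock R I :=
  monalg.mkmalgU w 1.

Definition vacuum (R : realType) (I : choiceType) : fock R I :=
  fock_word R [::].

(* Linear extension of a map given on the basis. *)
Definition fock_ext (R : realType) (I : choiceType) (f : seq I -> fock R I)
    (v : fock R I) : fock R I :=
  \sum_(w <- monalg.msupp v) monalg.mcoeff w v *: f w.

Definition remove_at (T : Type) (k : nat) (s : seq T) : seq T :=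
  take k s ++ drop k.+1 s.

(* The positions k are counted from 0, and i is also the (never used) default
   value of nth. *)
Fixpoint word_form (R : realType) (I : choiceType) (q : I -> I -> R)
    (u w : seq I) : R :=
  match u with
  | [::] => if w is [::] then 1 else 0
  | i :: u' =>
      \sum_(k < size w) (i == nth i w k)%:R *
        (\prod_(j <- take k w) q i j) * word_form q u' (remove_at k w)
  end.

(* Sesquilinear extension, linear in the first argument. *)
Definition fock_form (R : realType) (I : choiceType) (q : I -> I -> R)
    (u v : fock R I) : R[i] :=
  \sum_(w <- monalg.msupp u) \sum_(w' <- monalg.msupp v)
    monalg.mcoeff w u * (monalg.mcoeff w' v)^* * (word_form q w w')%:C.

Definition creation (R : realType) (I : choiceType) (i : I) :
    fock R I -> fock R I :=
  fock_ext (fun w => fock_word R (i :: w)).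

Definition annihilation (R : realType) (I : choiceType) (q : I -> I -> R)
    (i : I) : fock R I -> fock R I :=
  fock_ext (fun w => \sum_(k < size w)
    ((i == nth i w k)%:R * \prod_(j <- take k w) q i j)%:C *:
      fock_word R (remove_at k w)).

Definition qgauss (R : realType) (I : choiceType) (q : I -> I -> R) (i : I)
    (v : fock R I) : fock R I :=
  creation i v + annihilation q i v.

Definition vacuum_state (R : realType) (I : choiceType) (q : I -> I -> R)
    (a : fock R I -> fock R I) : R[i] :=
  fock_form q (a (vacuum R I)) (vacuum R I).

(* Main.v *)
Require Import Defs.
From mathcomp Require Import all_boot all_order all_algebra.
From mathcomp Require Import all_classical all_reals all_analysis.
From mathcomp Require Import complex.
From mathcomp Require finmap monalg.
Import (canonicals, coercions) finmap monalg.
From mathcomp Require Import ring lra zify.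
From mathcomp Require Import measurable_realfun.

Set Implicit Arguments.
Unset Strict Implicit.
Unset Printing Implicit Defensive.

Import Order.TTheory GRing.Theory Num.Theory.
Import numFieldNormedType.Exports.

Local Open Scope complex_scope.
Local Open Scope ring_scope.

(** Write [Psi S] for the monomial in the fermions indexed by a set [S], with
    the phase for which its square is 1. Two of them commute up to the sign
    (-1)^(|S| |U| + |S :&: U|). Expanding the trace of the product of the d
    random operators gives a sum over the families [x] of sets, one of the
    prescribed size for each of the d factors (the letters), of the expected
    product of the coefficients times the trace of the product of the
    [Psi (x m)].

    Combinatorics of the coefficients. By independence the expected product of
    coefficients vanishes as soon as one of them occurs only once, and it is 1
    when each occurs exactly twice. The families where each occurs at least
    twice and one occurs three times are too few to matter after normalisation
    ([coincident_negligible]), because the moments are uniformly bounded and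
    the traces have modulus at most 1. So the expectation may be replaced by
    the number of pair partitions of the letters that match equal coefficients
    ([expectation_monomial_wick]); this trades a case distinction for a sum
    over all pair partitions, each of which can be treated separately.

    Mean signs. For a family matched by a pair partition, the trace is the
    product over the crossings of the commutation signs ([Psi_pairing]). The
    normalisation turns the sum over such families into a mean over
    independent uniform sets, one for each block ([sum_wick_trace]). The
    blocks are averaged out one at a time. With the other sets fixed, the mean
    over a single set of size r is the mean of (-1)^|S :&: W|, where W is the
    symmetric difference of the sets that it crosses; this is a normalised
    Krawtchouk value, and it is exp(- 2 r |W| / n) up to an error that is
    small as soon as r / n and |W| / n are small, whatever the size of
    r |W| / n ([krawtchouk_approx]). As the densities tend to 0, the sets
    crossed are almost disjoint, hence |W| is close to the sum of their sizes
    in relative mean error ([big_symdiff_deficit]), which is what the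
    exponential tolerates even when its exponent tends to infinity
    ([expRN_dist]). Each crossing of blocks labelled i and j therefore
    contributes (-1)^(r_i r_j) exp(- 2 lambda_ij) in the limit
    ([family_mean_star], [cvg_star_mean]).

    The Fock space. In the vacuum coefficient of a product of operators
    creation + annihilation, a creation opens a block and an annihilation
    closes one, with weight the product of the q over the open blocks in front
    of it, that is, over the blocks that it crosses. The vacuum moment is
    therefore the same sum over pair partitions ([vacuum_state_pairings]). *)

(** * Mean of a sign over the subsets of a given size *)

Section Krawtchouk.
Variable R : realType.
Implicit Types (n w r j : nat).

Definition subset_mean n r (f : {set 'I_n} -> R) : R :=
  ('C(n, r)%:R)^-1 * \sum_(S : {set 'I_n} | #|S| == r) f S.

Definition krawtchouk_poly n w : {poly R} :=
  (1 - 'X) ^+ w * (1 + 'X) ^+ (n - w).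

(** Expanding the product over i of (1 + c_i X), with c_i = -1 on [W] and 1
    elsewhere, picks one term for each subset [S], of degree #|S|. *)
Lemma krawtchouk_poly_coef n r (W : {set 'I_n}) :
  \sum_(S : {set 'I_n} | #|S| == r) (-1) ^+ #|S :&: W|
    = (krawtchouk_poly n #|W|)`_r.
Proof.
pose c (i : 'I_n) : R := (-1) ^+ (i \in W).
have -> : krawtchouk_poly n #|W| = \prod_(i < n) ((c i)%:P * 'X + 1).
  rewrite (bigID (mem W)) /= /krawtchouk_poly; congr (_ * _).
    rewrite -prodr_const; apply: eq_bigr => i iW.
    by rewrite /c iW expr1 polyCN mulN1r addrC.
  have -> : (n - #|W| = #|~: W|)%N by rewrite [RHS]cardsCs finset.setCK card_ord.
  rewrite -prodr_const; apply: eq_big => [i|i iW]; first by rewrite finset.in_setC.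
  by rewrite finset.in_setC in iW; rewrite /c (negbTE iW) expr0 mul1r addrC.
rewrite bigA_distr coef_sum [RHS](bigID (fun S : {set 'I_n} => #|S| == r)) /=.
have E (S : {set 'I_n}) :
    \prod_i (if i \in S then (c i)%:P * 'X else 1)
    = ((-1) ^+ #|S :&: W|)%:P * 'X^(#|S|) :> {poly R}.
  rewrite -big_mkcond /= big_split /= prodr_const; congr (_ * _).
  rewrite rmorphXn /= -prodr_const (bigID (mem W)) /= [X in _ * X]big1 ?mulr1.
    rewrite [RHS](eq_bigl (fun i => (i \in S) && (i \in W))); last first.
      by move=> i; rewrite finset.in_setI.
    by apply: eq_bigr => i /andP[_ iW]; rewrite /c iW expr1.
  by move=> i /andP[_ iW]; rewrite /c (negbTE iW) expr0.
rewrite [X in _ + X]big1 ?addr0.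
  apply: eq_bigr => S /eqP <-.
  by rewrite E coefCM coefXn eqxx mulr1.
by move=> S Sr; rewrite E coefCM coefXn eq_sym (negbTE Sr) mulr0.
Qed.

(** Logarithmic derivative of the generating function; comparing coefficients
    yields the three-term recurrence that drives all the estimates below. *)
Lemma krawtchouk_poly_ode n w : (w <= n)%N ->
  (krawtchouk_poly n w)^`() * (1 - 'X ^+ 2) =
  krawtchouk_poly n w * (n%:R - w%:R *+ 2 - n%:R * 'X).
Proof.
move=> wn.
have dexp (l u : {poly R}) a : l^`() = u -> (l ^+ a)^`() * l = a%:R * u * l ^+ a.
  move=> lu; rewrite deriv_exp lu; case: a => [|a]; first by rewrite !(mul0r, mulr0n).
  by rewrite -mulr_natl /= exprSr !mulrA.
have d1 : (1 - 'X : {poly R})^`() = - 1 by rewrite derivB derivX derivC sub0r.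
have d2 : (1 + 'X : {poly R})^`() = 1 by rewrite derivD derivX derivC add0r.
rewrite /krawtchouk_poly derivM.
have := dexp _ _ w d1; have := dexp _ _ (n - w)%N d2; rewrite natrB //.
set u := (1 - 'X) ^+ w; set v := (1 + 'X) ^+ (n - w).
move: (u^`()) (v^`()) => u' v' Ev Eu.
have -> : 1 - 'X ^+ 2 = (1 - 'X) * (1 + 'X) :> {poly R} by rewrite -subr_sqr expr1n.
transitivity (u' * (1 - 'X) * v * (1 + 'X) + u * (v' * (1 + 'X)) * (1 - 'X)).
  by ring.
by rewrite Eu Ev; ring.
Qed.

Lemma krawtchouk_poly_rec n w r : (w <= n)%N ->
  r.+2%:R * (krawtchouk_poly n w)`_r.+2
  = (n%:R - w%:R *+ 2) * (krawtchouk_poly n w)`_r.+1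
    - (n%:R - r%:R) * (krawtchouk_poly n w)`_r.
Proof.
move=> wn; have := krawtchouk_poly_ode wn.
move: (krawtchouk_poly n w) => p.
rewrite mulrBr mulr1.
have -> : p * (n%:R - w%:R *+ 2 - n%:R * 'X)
    = (n%:R - w%:R *+ 2 : R)%:P * p - (n%:R : R)%:P * (p * 'X).
  by rewrite rmorphB rmorphMn !polyC_natr; ring.
move=> /(congr1 (fun u : {poly R} => u`_r.+1)).
rewrite !coefB !coefCM !coefMX coefMXn !coef_deriv /=.
case: r => [|r] /=; first by rewrite !subr0 -[p`_2 *+ 2]mulr_natl.
rewrite subSS subn1 /= -[p`_r.+3 *+ _]mulr_natl -[p`_r.+1 *+ _]mulr_natl => /eqP.
by rewrite subr_eq => /eqP ->; rewrite -[r.+1]addn1 natrD; ring.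
Qed.

Lemma krawtchouk_poly0 n w : (krawtchouk_poly n w)`_0 = 1.
Proof. by rewrite -horner_coef0 /krawtchouk_poly !hornerE /= !(subr0, addr0, expr1n, mulr1). Qed.

Lemma krawtchouk_poly1 n w : (w <= n)%N ->
  (krawtchouk_poly n w)`_1 = n%:R - w%:R *+ 2.
Proof.
move=> wn; have := krawtchouk_poly_ode wn.
move: (krawtchouk_poly n w) (krawtchouk_poly0 n w) => p p0.
rewrite mulrBr mulr1.
have -> : p * (n%:R - w%:R *+ 2 - n%:R * 'X)
    = (n%:R - w%:R *+ 2 : R)%:P * p - (n%:R : R)%:P * (p * 'X).
  by rewrite rmorphB rmorphMn !polyC_natr; ring.
move=> /(congr1 (fun u : {poly R} => u`_0)).
by rewrite !coefB !coefCM !coefMX coefMXn !coef_deriv /= p0 !subr0 mulr0 subr0 mulr1.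
Qed.

(** The value at [w] of the Krawtchouk polynomial of degree [r], normalised to
    be 1 at w = 0. *)
Definition krawtchouk n w r : R := (krawtchouk_poly n w)`_r / 'C(n, r)%:R.

Lemma krawtchouk_rec n w r : (w <= n)%N -> (r < n)%N ->
  (n%:R - r%:R) * krawtchouk n w r.+1
  = (n%:R - w%:R *+ 2) * krawtchouk n w r - r%:R * krawtchouk n w r.-1.
Proof.
move=> wn rn; rewrite /krawtchouk.
case: r rn => [|r] rn.
  rewrite /= krawtchouk_poly1 // bin0 bin1 krawtchouk_poly0 !subr0 mul0r subr0.
  have : (n%:R : R) != 0 by rewrite pnatr_eq0; lia.
  by move=> n0; field.
rewrite /=.
have E1 : (r.+2 * 'C(n, r.+2) = (n - r.+1) * 'C(n, r.+1))%N by rewrite mul_bin_left.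
have E0 : (r.+1 * 'C(n, r.+1) = (n - r) * 'C(n, r))%N by rewrite mul_bin_left.
move: E1 E0 => /(congr1 (fun m => m%:R : R)) E1 /(congr1 (fun m => m%:R : R)) E0.
rewrite !natrM !natrB in E1 E0; [|lia|lia].
have b0 : ('C(n, r)%:R : R) != 0 by rewrite pnatr_eq0 -lt0n bin_gt0; lia.
have b1 : ('C(n, r.+1)%:R : R) != 0 by rewrite pnatr_eq0 -lt0n bin_gt0; lia.
have b2 : (r.+2 < n)%N -> ('C(n, r.+2)%:R : R) != 0 by rewrite pnatr_eq0 -lt0n bin_gt0; lia.
have r1 : (r.+1%:R : R) != 0 by rewrite pnatr_eq0.
have r2 : (r.+2%:R : R) != 0 by rewrite pnatr_eq0.
have c0 : ((n%:R : R) - r%:R) != 0 by rewrite subr_eq0 eqr_nat; lia.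
have c1 : ((n%:R : R) - r.+1%:R) != 0 by rewrite subr_eq0 eqr_nat; lia.
have e0 : ('C(n, r)%:R : R) = r.+1%:R * 'C(n, r.+1)%:R / (n%:R - r%:R).
  by rewrite E0; field.
have e2 : ('C(n, r.+2)%:R : R) = (n%:R - r.+1%:R) * 'C(n, r.+1)%:R / r.+2%:R.
  by rewrite -E1; field.
have := krawtchouk_poly_rec r wn.
move: (krawtchouk_poly n w) => p E.
have e3 : p`_r.+2 = ((n%:R - w%:R *+ 2) * p`_r.+1 - (n%:R - r%:R) * p`_r) / r.+2%:R.
  by rewrite -E; field.
rewrite e3 e0 e2.
move: b1 r1 r2 c0 c1.
move: (r.+1%:R : R) (r.+2%:R : R) ('C(n, r.+1)%:R : R) (n%:R - r%:R : R).
move=> x1 x2 x3 x4 b1 r1 r2 c0 c1.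
by field; rewrite ?b1 ?r1 ?r2 ?c0 ?c1.
Qed.

Lemma krawtchouk0 n w : krawtchouk n w 0 = 1.
Proof. by rewrite /krawtchouk krawtchouk_poly0 bin0 divr1. Qed.

(** By induction on [j]: as K_(j-1) lies between K_j and K_j / (1 - T), the
    recurrence confines the ratio K_(j+1) / K_j to the interval from 1 - T to
    1 - a. The constant 6 in [T] is what closes the induction for the lower
    bound, and eps <= 1/16 keeps 1 - T positive and j below n. *)
Lemma krawtchouk_ratio n w r (eps : R) :
  0 <= eps -> eps <= 16^-1 -> (0 < n)%N -> (w <= n)%N ->
  w%:R <= eps * n%:R -> r%:R <= eps * n%:R ->
  let a := 2 * w%:R / n%:R in let T := a * (1 + 6 * eps) in
  forall j, (j <= r)%N ->
    [/\ 0 < krawtchouk n w j,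
        (1 - T) * krawtchouk n w j <= krawtchouk n w j.+1 &
        krawtchouk n w j.+1 <= (1 - a) * krawtchouk n w j].
Proof.
move=> e0 e8 n0 wn we re a T.
have N0 : 0 < n%:R :> R by rewrite ltr0n.
have an : 2 * w%:R = a * n%:R by rewrite /a mulfVK ?gt_eqF.
have a0 : 0 <= a by rewrite /a !mulr_ge0 ?invr_ge0 ?ler0n.
have a2 : a <= 2 * eps by rewrite /a ler_pdivrMr //; lra.
have T0 : a <= T by rewrite /T; nra.
have T2 : T <= 4 * eps by rewrite /T; nra.
elim=> [|j IH] jr.
  have := @krawtchouk_rec n w 0 wn n0.
  rewrite krawtchouk0 /= subr0 mul0r subr0 mulr1 => E.
  have E1 : krawtchouk n w 1 = 1 - a.
    apply: (mulfI (lt0r_neq0 N0)); rewrite E mulrBr mulr1 [_ * a]mulrC -an.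
    by rewrite mulr_natl.
  by rewrite E1 !mulr1; split; [exact: ltr01|lra|].
have [K0 lo up] := IH (ltnW jr).
have jn : (j.+1 < n)%N.
  have : (r%:R : R) <= 16^-1 * n%:R by nra.
  rewrite mulrC ler_pdivlMr ?ltr0n // -natrM ler_nat.
  by clear -jr n0 => h; lia.
have := @krawtchouk_rec n w j.+1 wn jn; rewrite /=.
move: (krawtchouk n w j) (krawtchouk n w j.+1) (krawtchouk n w j.+2) K0 lo up.
move=> x y z K0 lo up E.
have y0 : 0 < y by nra.
have Je : (j.+1%:R : R) <= eps * n%:R by apply: le_trans re; rewrite ler_nat.
have J0 : (0 : R) <= j.+1%:R by [].
move: (j.+1%:R : R) Je J0 E => J Je J0 E.
have w2 : w%:R *+ 2 = a * n%:R by rewrite -mulr_natl an.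
rewrite w2 in E.
have NJ : 0 < n%:R - J by nra.
move: (n%:R : R) N0 Je NJ E {we re an w2} => N N0 Je NJ E.
clearbody a.
split => //.
  rewrite -(ler_pM2l NJ) E.
  have T1 : 0 < 1 - T by lra.
  have Jx : J * (x * (1 - T)) <= J * y by rewrite ler_wpM2l //; nra.
  rewrite -(ler_pM2r T1).
  have key : J * (T * (2 - T)) <= N * (1 - T) * (T - a).
    apply: (@le_trans _ _ (eps * N * (T * (2 - T)))).
      by rewrite ler_wpM2r // mulr_ge0; lra.
    have -> : N * (1 - T) * (T - a) = (eps * N) * (6 * a * (1 - T)).
      by rewrite /T; ring.
    rewrite ler_wpM2l ?(mulr_ge0 e0 (ltW N0)) //.
    rewrite {1}/T -mulrA [6 * a]mulrC -mulrA ler_wpM2l //.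
    nra.
  have := ler_wpM2r (ltW y0) key; nra.
rewrite -(ler_pM2l NJ) E.
have xy : J * y <= J * x by rewrite ler_wpM2l //; nra.
have : 0 <= J * a * y by rewrite !mulr_ge0 // ltW.
nra.
Qed.

(** The inverse of the usual bound 1 + z <= exp z, at z = y / (1 - y). *)
Lemma expR_lower_inv (y : R) : y < 1 -> expR (- (y / (1 - y))) <= 1 - y.
Proof.
move=> y1; rewrite expRN -[leRHS]invrK lef_pV2 ?posrE ?expR_gt0 ?invr_gt0 ?subr_gt0 //.
apply: le_trans (expR_ge1Dx _); rewrite le_eqVlt; apply/orP; left; apply/eqP.
by field; lra.
Qed.

Lemma mul_expRN_le1 (x : R) : x * expR (- x) <= 1.
Proof.
rewrite expRN ler_pdivrMr ?expR_gt0 // mul1r.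
by apply: le_trans (expR_ge1Dx _); lra.
Qed.

(** Multiplying the ratio bounds compares the value with (1 - a)^r and
    (1 - T)^r. The lower bound loses a relative error 20 eps x where x is the
    exponent; since x exp(- x) <= 1, the absolute error does not depend on x.
    This uniformity covers the infinite values of lambda. *)
Lemma krawtchouk_approx n w r (eps : R) :
  0 <= eps -> eps <= 16^-1 -> (0 < n)%N -> (w <= n)%N ->
  w%:R <= eps * n%:R -> r%:R <= eps * n%:R ->
  `|krawtchouk n w r - expR (- (2 * (r%:R * w%:R / n%:R)))| <= 20 * eps.
Proof.
move=> e0 e8 n0 wn we re.
have := krawtchouk_ratio e0 e8 n0 wn we re => /=.
set a := 2 * w%:R / n%:R; set T := a * (1 + 6 * eps) => step.
have N0 : 0 < n%:R :> R by rewrite ltr0n.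
have a0 : 0 <= a by rewrite /a !mulr_ge0 ?invr_ge0 ?ler0n.
have a2 : a <= 2 * eps by rewrite /a ler_pdivrMr //; lra.
have T0 : a <= T by rewrite /T; nra.
have T2 : T <= 4 * eps by rewrite /T; nra.
have bnd j : (j <= r)%N -> (1 - T) ^+ j <= krawtchouk n w j <= (1 - a) ^+ j.
  elim: j => [|j IH] jr; first by rewrite krawtchouk0 !expr0 lexx.
  have [K0 lo up] := step j (ltnW jr); have /andP[lo' up'] := IH (ltnW jr).
  rewrite !exprS; apply/andP; split.
    by apply: le_trans lo; rewrite ler_wpM2l //; lra.
  by apply: (le_trans up); rewrite ler_wpM2l //; lra.
have /andP[lo up] := bnd r (leqnn r).
have -> : 2 * (r%:R * w%:R / n%:R) = a * r%:R by rewrite /a; field; rewrite gt_eqF.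
set x := a * r%:R.
have x0 : 0 <= x by rewrite mulr_ge0.
have up2 : krawtchouk n w r <= expR (- x).
  apply: (le_trans up); rewrite /x -[- (_ * r%:R)]mulNr expRM_natr.
  by rewrite lerXn2r ?nnegrE ?expR_ge0 ?expR_ge1Dx //; lra.
have lo2 : expR (- x) * (1 - 20 * eps * x) <= krawtchouk n w r.
  apply: le_trans lo; apply: (@le_trans _ _ (expR (- (T / (1 - T))) ^+ r)); last first.
    rewrite lerXn2r ?nnegrE ?expR_ge0 ?expR_lower_inv //; lra.
  rewrite -expRM_natr.
  apply: (@le_trans _ _ (expR (- x) * expR (- (20 * eps * x)))).
    by rewrite ler_wpM2l ?expR_ge0 // expR_ge1Dx.
  rewrite -expRD ler_expR.
  suff h : T / (1 - T) <= a * (1 + 20 * eps).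
    by have := ler_wpM2r (ler0n R r) h; rewrite /x; nra.
  rewrite ler_pdivrMr; last lra.
  rewrite -mulrA {1}/T ler_wpM2l //; nra.
have := mul_expRN_le1 x; have := expR_gt0 (- x).
by move=> ? ?; rewrite ler_norml; nra.
Qed.

(** A relative error in the exponent costs at most twice that error in the
    exponential, however large the exponent is. *)
Lemma expRN_dist (x y : R) : 0 <= y -> y <= x ->
  x * `|expR (- y) - expR (- x)| <= 2 * (x - y).
Proof.
move=> y0 yx; rewrite ger0_norm; last by rewrite subr_ge0 ler_expR; lra.
have ey := expR_gt0 (- y).
have e1 : expR (- y) <= 1 by rewrite -expR0 ler_expR; lra.
have -> : expR (- x) = expR (- y) * expR (- (x - y)).
  by rewrite -expRD; congr expR; lra.
have lo : 1 - (x - y) <= expR (- (x - y)) by apply: expR_ge1Dx.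
have f0 := expR_gt0 (- (x - y)).
have := mul_expRN_le1 y.
move: (expR (- y)) (expR (- (x - y))) ey e1 lo f0 => u v u0 u1 lo v0 yu.
have h1 : (y * u) * (1 - v) <= x - y.
  have [v1|v1] := leP v 1; first by nra.
  have : 0 <= y * u by nra.
  nra.
have h2 : (x - y) * (u * (1 - v)) <= x - y.
  by rewrite -[leRHS]mulr1 ler_wpM2l //; [lra|nra].
nra.
Qed.
End Krawtchouk.

Section SymmetricDifference.
Variables (n : nat).
Implicit Types (A B S : {set 'I_n}).

Definition symdiff A B : {set 'I_n} := [set i | (i \in A) (+) (i \in B)]%SET.

Lemma sign_card_setI (R : comPzRingType) S A :
  (-1) ^+ #|S :&: A| = \prod_(i in S) (-1) ^+ (i \in A) :> R.
Proof.
rewrite -prodr_const [RHS](bigID (mem A)) /= [X in _ * X]big1 ?mulr1; last first.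
  by move=> i /andP[_ /negbTE->].
rewrite [LHS](eq_bigl (fun i => (i \in S) && (i \in A))); last first.
  by move=> i; rewrite finset.in_setI.
by apply: eq_bigr => i /andP[_ ->].
Qed.

Lemma sign_card_symdiff (R : comPzRingType) S A B :
  (-1) ^+ #|S :&: symdiff A B| = (-1) ^+ #|S :&: A| * (-1) ^+ #|S :&: B| :> R.
Proof.
rewrite !sign_card_setI -big_split; apply: eq_bigr => i _.
by rewrite inE signr_addb.
Qed.

Lemma card_symdiff A B : (#|symdiff A B| + 2 * #|A :&: B| = #|A| + #|B|)%N.
Proof.
have -> : symdiff A B = (A :\: B) :|: (B :\: A).
  by apply/setP => i; rewrite !inE; case: (i \in A); case: (i \in B).
rewrite cardsU -(cardsID B A) -(cardsID A B) [B :&: A]finset.setIC.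
have -> : (A :\: B) :&: (B :\: A) = finset.set0.
  by apply/setP => i; rewrite !inE; case: (i \in A); case: (i \in B).
by rewrite cards0; lia.
Qed.
End SymmetricDifference.

(** * Means over families of independent uniform subsets *)

Section SubsetMean.
Variable R : realType.

Lemma subset_mean_sign n r (W : {set 'I_n}) :
  subset_mean r (fun S => (-1) ^+ #|S :&: W|) = krawtchouk R n #|W| r.
Proof. by rewrite /subset_mean krawtchouk_poly_coef mulrC. Qed.

Lemma subset_mean_const n r (c : R) : (r <= n)%N ->
  subset_mean r (fun _ : {set 'I_n} => c) = c.
Proof.
move=> rn; rewrite /subset_mean sumr_const.
have -> : #|[pred S : {set 'I_n} | #|S| == r]| = 'C(n, r).
  rewrite -[in RHS](card_ord n) -card_draws.
  by apply: eq_card => S; rewrite !inE.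
rewrite -[c *+ _]mulr_natl mulrA mulVf ?mul1r //.
by rewrite pnatr_eq0 -lt0n bin_gt0.
Qed.

(** Each element of [W] lies in a random set of size [r] with probability
    r / n. *)
Lemma subset_mean_card n r (W : {set 'I_n}) : (r <= n)%N ->
  n%:R * subset_mean r (fun S => #|S :&: W|%:R : R) = r%:R * #|W|%:R.
Proof.
move=> rn.
have cj (j : 'I_n) : (n * \sum_(S : {set 'I_n} | #|S| == r) (j \in S) = r * 'C(n, r))%N.
  have -> : (\sum_(S : {set 'I_n} | #|S| == r) (j \in S)
      = 'C(n, r) - 'C(n.-1, r))%N.
    rewrite -big_mkcondr /= sum1_card.
    have := cardsID [set S : {set 'I_n} | j \in S]%SET [set S : {set 'I_n} | #|S| == r]%SET.
    rewrite card_draws card_ord.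
    have -> : #|[set S : {set 'I_n} | #|S| == r]%SET :\: [set S : {set 'I_n} | j \in S]%SET|
        = 'C(n.-1, r).
      rewrite -(_ : #|~: [set j]%SET| = n.-1).
        rewrite -cards_draws; apply: eq_card => S.
        by rewrite !inE finset.subsetC finset.sub1set inE.
      by rewrite cardsC1 card_ord.
    move=> <-; rewrite addnK; apply: eq_card => S.
    by rewrite !inE.
  case: n j W rn => [|n] j W rn; first by case: j.
  case: r rn => [|r] rn; first by rewrite !bin0 subnn muln0.
  by rewrite binS addKn mul_bin_diag.
rewrite /subset_mean mulrCA.
have -> : \sum_(S : {set 'I_n} | #|S| == r) (#|S :&: W|%:R : R)
    = \sum_(j in W) \sum_(S : {set 'I_n} | #|S| == r) (j \in S)%:R.
  rewrite exchange_big /=; apply: eq_bigr => S _.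
  rewrite -natr_sum; congr _%:R.
  rewrite -sum1_card big_mkcond [RHS]big_mkcond /=; apply: eq_bigr => j _.
  by rewrite finset.in_setI; case: (j \in S); case: (j \in W).
rewrite mulr_sumr.
under eq_bigr do rewrite -natr_sum -natrM cj.
rewrite sumr_const natrM -[_ *+ _]mulr_natr.
have : ('C(n, r)%:R : R) != 0 by rewrite pnatr_eq0 -lt0n bin_gt0.
by move=> ?; field.
Qed.
End SubsetMean.

Section FamilyMean.
Variables (R : realType) (L : finType) (n : nat) (rr : L -> nat).
Hypothesis rrn : forall a, (rr a <= n)%N.
Implicit Types (a b : L) (S : {set 'I_n}).
Local Notation fam := {ffun L -> {set 'I_n}}.
Implicit Types (x : fam) (f g : fam -> R).

Definition sized x : bool := [forall a, #|x a| == rr a].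

Definition family_mean f : R :=
  (\prod_a 'C(n, rr a)%:R)^-1 * \sum_(x | sized x) f x.

Definition upd x a S : fam := [ffun b => if b == a then S else x b].

Definition indep_of a f := forall x S, f (upd x a S) = f x.

Lemma upd_same x a S : upd x a S a = S.
Proof. by rewrite ffunE eqxx. Qed.

Lemma upd_other x a S b : b != a -> upd x a S b = x b.
Proof. by rewrite ffunE => /negbTE->. Qed.

Lemma sizedP x : reflect (forall a, #|x a| = rr a) (sized x).
Proof. by apply: (iffP forallP) => h a; apply/eqP. Qed.

Let c_gt0 a : 0 < 'C(n, rr a)%:R :> R.
Proof. by rewrite ltr0n bin_gt0. Qed.

Let C_gt0 : 0 < \prod_a 'C(n, rr a)%:R :> R.
Proof. by apply: prodr_gt0 => a _. Qed.

(** The coordinates of a uniform family are independent and uniform, so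
    redrawing one of them does not change a mean. Formally, exchanging the
    coordinate at [a] with the new set is an involution that preserves the
    counting measure on pairs of a family and a set. *)
Lemma family_mean_resample a f :
  family_mean f = family_mean (fun x => subset_mean (rr a) (fun S => f (upd x a S))).
Proof.
rewrite /family_mean /subset_mean -mulr_sumr; congr (_ * _).
rewrite pair_big_dep /=.
pose h (p : fam * {set 'I_n}) := (upd p.1 a p.2, p.1 a).
have hK : involutive h.
  case=> x S; rewrite /h /= upd_same; congr (_, _).
  by apply/ffunP => b; rewrite !ffunE; case: eqP => [->|].
rewrite (reindex_inj (inv_inj hK)) /=.
rewrite (eq_bigl (fun p : fam * {set 'I_n} => sized p.1 && (#|p.2| == rr a))).
  rewrite (eq_bigr (fun p => f p.1)); last first.
    move=> [x S] /= _; congr f.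
    by apply/ffunP => b; rewrite !ffunE; case: eqP => [->|].
  rewrite -(pair_big sized (fun S : {set 'I_n} => #|S| == rr a) (fun x _ => f x)) /=.
  rewrite mulr_sumr; apply: eq_bigr => x _.
  by have := subset_mean_const (f x) (rrn a).
case=> x S /=; apply/andP/andP => -[/sizedP sx /eqP sS]; split.
- apply/sizedP => b; have [->//|ba] := eqVneq b a.
  by have := sx b; rewrite upd_other.
- by have := sx a; rewrite upd_same => ->.
- by apply/sizedP => b; rewrite ffunE; case: eqP => [->|].
- by rewrite sx.
Qed.

Lemma eq_family_mean f g : (forall x, sized x -> f x = g x) ->
  family_mean f = family_mean g.
Proof. by move=> fg; rewrite /family_mean; congr (_ * _); exact: eq_bigr. Qed.

Lemma family_mean_le f g : (forall x, sized x -> f x <= g x) ->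
  family_mean f <= family_mean g.
Proof.
move=> fg; rewrite /family_mean ler_wpM2l ?invr_ge0 ?(ltW C_gt0) //.
exact: ler_sum.
Qed.

Lemma family_meanD f g :
  family_mean (fun x => f x + g x) = family_mean f + family_mean g.
Proof. by rewrite /family_mean big_split mulrDr. Qed.

Lemma family_meanZ k f : family_mean (fun x => k * f x) = k * family_mean f.
Proof. by rewrite /family_mean -mulr_sumr mulrCA. Qed.

Lemma family_meanB f g :
  family_mean (fun x => f x - g x) = family_mean f - family_mean g.
Proof. by rewrite /family_mean big_split sumrN mulrBr. Qed.

Lemma family_mean_norm f :
  `|family_mean f| <= family_mean (fun x => `|f x|).
Proof.
rewrite /family_mean normrM ger0_norm ?invr_ge0 ?(ltW C_gt0) //.
by rewrite ler_wpM2l ?invr_ge0 ?(ltW C_gt0) // ler_norm_sum.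
Qed.

Lemma card_sized : (\sum_(x | sized x) 1 = \prod_a 'C(n, rr a))%N.
Proof.
rewrite sum1_card.
pose F a := [pred S : {set 'I_n} | #|S| == rr a].
rewrite (eq_card (B := family F)); last first.
  move=> x; rewrite !inE; apply/sizedP/familyP => h a; have := h a; rewrite !inE.
    by move=> ->.
  by move=> /eqP.
rewrite card_family.
have -> (G : L -> nat) : foldr muln 1%N [seq G a | a : L] = (\prod_a G a)%N.
  by rewrite unlock /reducebig /= foldr_map enumT.
apply: eq_bigr => a _.
rewrite -[in RHS](card_ord n) -card_draws.
by apply: eq_card => S; rewrite !inE.
Qed.

Lemma family_mean_const k : family_mean (fun=> k) = k.
Proof.
rewrite /family_mean.
have -> : \sum_(x | sized x) k = k * \prod_a 'C(n, rr a)%:R.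
  rewrite -natr_prod -card_sized natr_sum mulr_sumr.
  by apply: eq_bigr => x _; rewrite mulr1.
by rewrite mulrCA mulVf ?mulr1 // gt_eqF.
Qed.

(** The coordinate at [m] hits [x v] with probability 1 / 'C(n, rr m), which
    the weight 'C(n, rr m) compensates. This is how matched letters are merged
    into one block. *)
Lemma family_mean_collision m v h : v != m -> rr m = rr v -> indep_of m h ->
  family_mean (fun x => 'C(n, rr m)%:R * (x m == x v)%:R * h x) = family_mean h.
Proof.
move=> mv rmv hm; rewrite (family_mean_resample m).
apply: eq_family_mean => x /sizedP sx; rewrite /subset_mean.
rewrite (bigD1 (x v)) ?sx ?rmv //= big1 ?addr0; last first.
  by move=> S /andP[_ /negbTE Sv]; rewrite upd_same upd_other // Sv mulr0 mul0r.
rewrite upd_same upd_other // eqxx mulr1 hm mulrA -rmv mulVf ?mul1r //.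
by rewrite gt_eqF.
Qed.
End FamilyMean.

(** * Pair partitions read from their crossings *)

Section Stars.
Variable L : eqType.
Implicit Types (t : L * L * seq L) (p : seq (L * L * seq L)).

(** A pair partition is recorded as a list of stars (m, v, N), one for each
    block, in the order in which the blocks are closed: the letter [m] closes
    the block opened by [v], and [N] lists the letters that were opened after
    [v] and are still open. The blocks opened by the letters of [N] are exactly
    the ones that cross the block of [v] and are closed later, so that each
    crossing is recorded once, in the star of the block that is closed
    first. *)
Definition star_labels t : seq L := [:: t.1.1, t.1.2 & t.2].

(** The two labels of a star do not occur in the later stars, and no later
    closing letter is in its [N]. Hence, in the order of the list, a block can
    be averaged out while the sets attached to the later blocks are kept. *)
Fixpoint well_formed p : bool :=
  if p is t :: p' then
    [&& t.1.2 != t.1.1, t.1.1 \notin t.2, t.1.2 \notin t.2, uniq t.2,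
        all (fun t' => [&& t.1.1 \notin star_labels t',
                           t.1.2 \notin star_labels t' & t'.1.1 \notin t.2]) p'
      & well_formed p']
  else true.

Definition star_weight (C : pzRingType) (g : L -> L -> C) p : C :=
  \prod_(t <- p) \prod_(a <- t.2) g t.1.2 a.

Lemma star_weight_cons (C : pzRingType) (g : L -> L -> C) t p :
  star_weight g (t :: p) = (\prod_(a <- t.2) g t.1.2 a) * star_weight g p.
Proof. by rewrite /star_weight big_cons. Qed.
End Stars.

Section FamilySigns.
Variables (R : realType) (L : finType) (n : nat) (rr : L -> nat).
Hypothesis rrn : forall a, (rr a <= n)%N.
Implicit Types (a b m v : L) (S : {set 'I_n}).
Local Notation fam := {ffun L -> {set 'I_n}}.
Implicit Types (x : fam) (f g : fam -> R).
Implicit Types (t : L * L * seq L) (p : seq (L * L * seq L)).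

Definition pair_sign x a b : R := (-1) ^+ (rr a * rr b + #|x a :&: x b|).

(** Indicator of a match, scaled to have mean 1. *)
Definition collision m v x : R := 'C(n, rr m)%:R * (x m == x v)%:R.

Lemma indep_of_mul a f g : indep_of a f -> indep_of a g ->
  indep_of a (fun x => f x * g x).
Proof. by move=> fa ga x S; rewrite fa ga. Qed.

Lemma indep_of_pair_sign a b c : a != b -> a != c ->
  indep_of a (fun x => pair_sign x b c).
Proof. by move=> ab ac x S; rewrite /pair_sign !upd_other // eq_sym. Qed.

Lemma indep_of_star a t : a \notin t.2 -> a != t.1.2 ->
  indep_of a (fun x => \prod_(b <- t.2) pair_sign x t.1.2 b).
Proof.
move=> aN av x S; apply: eq_big_seq => b bN; apply: indep_of_pair_sign => //.
by apply: contraNneq aN => ->.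
Qed.

Lemma indep_of_star_weight a p : {in p, forall t, a \notin star_labels t} ->
  indep_of a (fun x => star_weight (pair_sign x) p).
Proof.
move=> ap x S; apply: eq_big_seq => t /ap; rewrite !inE !negb_or => /and3P[_ av aN].
exact: indep_of_star.
Qed.

(** Conditioning on all matches of a pair partition amounts to forgetting the
    closing letters: the signs only involve the opening letters. *)
Lemma family_mean_collisions p g : well_formed p ->
  {in p, forall t, rr t.1.1 = rr t.1.2} ->
  {in p, forall t, indep_of t.1.1 g} ->
  family_mean rr (fun x => (\prod_(t <- p) collision t.1.1 t.1.2 x)
                           * (star_weight (pair_sign x) p * g x))
  = family_mean rr (fun x => star_weight (pair_sign x) p * g x).
Proof.
elim: p g => [|t p IH] g /=; first by move=> *; apply: eq_family_mean => x _; rewrite big_nil mul1r.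
move=> /and5P[vm mN vN _ /andP[/allP tp wp]] rp gp.
have IH' := IH (fun x => (\prod_(b <- t.2) pair_sign x t.1.2 b) * g x) wp.
under [RHS]eq_family_mean do rewrite star_weight_cons -mulrA mulrCA.
rewrite -IH'; last 2 first.
- by move=> t' t'p; apply: rp; rewrite inE t'p orbT.
- move=> t' t'p; apply: indep_of_mul; last by apply: gp; rewrite inE t'p orbT.
  have /and3P[_ vt t'N] := tp _ t'p.
  apply: indep_of_star => //.
  by move: vt; rewrite !inE !negb_or eq_sym => /andP[].
rewrite -[RHS](family_mean_collision rrn vm); last 2 first.
- by apply: rp; rewrite inE eqxx.
- apply: indep_of_mul; last apply: indep_of_mul; last apply: indep_of_mul.
  + move=> x S; apply: eq_big_seq => t' t'p.
    have /and3P[mt _ _] := tp _ t'p; move: mt; rewrite !inE !negb_or => /and3P[m1 m2 _].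
    by rewrite /collision !upd_other // eq_sym.
  + by apply: indep_of_star_weight => t' t'p; have /and3P[] := tp _ t'p.
  + by apply: indep_of_star => //; rewrite eq_sym.
  + by apply: gp; rewrite inE eqxx.
apply: eq_family_mean => x _; rewrite big_cons star_weight_cons /collision.
by ring.
Qed.

(** Multiplying the signs attached to several sets gives the sign attached to
    their symmetric difference, see [sign_card_big_symdiff]. *)
Definition big_symdiff (N : seq L) x : {set 'I_n} :=
  foldr (fun a W => symdiff (x a) W) finset.set0 N.

Lemma sign_card_big_symdiff N x S :
  (-1) ^+ #|S :&: big_symdiff N x| = \prod_(a <- N) (-1) ^+ #|S :&: x a| :> R.
Proof.
elim: N => [|a N IH]; first by rewrite big_nil /= finset.setI0 cards0.
by rewrite big_cons /= sign_card_symdiff IH.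
Qed.

Definition total_size (N : seq L) : nat := \sum_(a <- N) rr a.

Lemma card_big_symdiff_le N x : sized rr x -> (#|big_symdiff N x| <= total_size N)%N.
Proof.
move=> /sizedP sx; elim: N => [|a N IH]; first by rewrite /= cards0.
rewrite /total_size big_cons /= -sx; have E := card_symdiff (x a) (big_symdiff N x).
apply: leq_trans (leq_add (leqnn _) IH); rewrite -E; exact: leq_addr.
Qed.

(** Adding a set to a symmetric difference loses twice the size of their
    intersection, which in the mean is at most the product of the sizes
    divided by [n]. The bound is quadratic in the total size, so the relative
    loss is at most the density. *)
Lemma big_symdiff_deficit N : uniq N ->
  n%:R * family_mean rr (fun x => (total_size N)%:R - #|big_symdiff N x|%:R)
    <= (total_size N)%:R ^+ 2 :> R.
Proof.
elim: N => [|a N IH] /=.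
  move=> _; rewrite (eq_family_mean (g := fun=> 0)) ?family_mean_const //.
    by rewrite mulr0 sqr_ge0.
  by move=> x _; rewrite cards0 /total_size big_nil subrr.
move=> /andP[aN /IH {}IH].
have tE : total_size (a :: N) = (rr a + total_size N)%N by rewrite /total_size big_cons.
pose f x : R := #|x a :&: big_symdiff N x|%:R.
have E : family_mean rr (fun x => (total_size (a :: N))%:R
      - #|symdiff (x a) (big_symdiff N x)|%:R)
    = family_mean rr (fun x => (total_size N)%:R - #|big_symdiff N x|%:R)
      + 2 * family_mean rr f :> R.
  rewrite -family_meanZ -family_meanD; apply: eq_family_mean => x /sizedP sx.
  have := card_symdiff (x a) (big_symdiff N x); rewrite tE sx => /(congr1 (fun k => k%:R : R)).
  by rewrite mul2n -addnn !natrD /f; lra.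
have Wa S x : big_symdiff N (upd x a S) = big_symdiff N x.
  elim: N aN {IH tE f E} => //= b N IH; rewrite inE negb_or => /andP[ab bN].
  by rewrite IH // upd_other // eq_sym.
have F : n%:R * family_mean rr f <= (rr a)%:R * (total_size N)%:R.
  rewrite (family_mean_resample rrn a) -family_meanZ.
  rewrite -[leRHS](family_mean_const rrn ((rr a)%:R * (total_size N)%:R)).
  apply: (family_mean_le rrn) => x sx.
  rewrite /f.
  under eq_fun do rewrite upd_same Wa.
  rewrite subset_mean_card // ler_wpM2l // ler_nat.
  exact: card_big_symdiff_le.
rewrite E tE natrD; nra.
Qed.

(** What a crossing contributes at size [n]; for given labels it tends to the
    corresponding entry of the matrix q. *)
Definition pair_limit a b : R :=
  (-1) ^+ (rr a * rr b) * expR (- (2 * ((rr a)%:R * (rr b)%:R / n%:R))).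

(** Averaging out the first star. Given all other sets, the mean over the set
    at [v] is a Krawtchouk value at the size of the symmetric difference of the
    sets in [N]; this is replaced by the exponential, at cost 20 eps, and then
    the size by the sum of the sizes, at cost 2 eps. What remains has modulus 1
    and does not involve [v]. *)
Lemma family_mean_star t p (eps := (rr t.1.2 + total_size t.2)%:R / n%:R : R) :
  (0 < n)%N -> eps <= 16^-1 -> well_formed (t :: p) ->
  `| family_mean rr (fun x => star_weight (pair_sign x) (t :: p))
     - (\prod_(a <- t.2) pair_limit t.1.2 a)
       * family_mean rr (fun x => star_weight (pair_sign x) p) | <= 22 * eps.
Proof.
move=> n0 e16 /= /and5P[_ _ vN uN /andP[/allP tp _]].
set v := t.1.2; set N := t.2.
have N0 : 0 < n%:R :> R by rewrite ltr0n.
have e0 : 0 <= eps by rewrite /eps divr_ge0.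
pose sgn : R := \prod_(a <- N) (-1) ^+ (rr v * rr a).
pose X : R := expR (- (2 * ((rr v)%:R * (total_size N)%:R / n%:R))).
pose w x := star_weight (pair_sign x) p.
have limE : \prod_(a <- N) pair_limit v a = sgn * X.
  rewrite /pair_limit big_split /=; congr (_ * _).
  rewrite /X /total_size; elim: (N) => [|a M IH].
    by rewrite !big_nil mulr0 mul0r mulr0 oppr0 expR0.
  by rewrite !big_cons IH -expRD natrD; congr expR; ring.
have sgn1 : `|sgn| = 1 by rewrite normr_prod big1 // => a _; rewrite normr_sign.
have w1 x : `|w x| = 1.
  rewrite normr_prod big1 // => t' _.
  by rewrite normr_prod big1 // => a _; rewrite normr_sign.
pose K x := krawtchouk R n #|big_symdiff N x| (rr v).
have meanE : family_mean rr (fun x => star_weight (pair_sign x) (t :: p))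
    = family_mean rr (fun x => sgn * K x * w x).
  rewrite (family_mean_resample rrn v); apply: eq_family_mean => x _.
  rewrite /K -subset_mean_sign /subset_mean mulrCA -!mulrA; congr (_ * _).
  rewrite mulrA mulr_sumr mulr_suml; apply: eq_bigr => S _.
  rewrite star_weight_cons indep_of_star_weight; last first.
    by move=> t' /tp /and3P[].
  congr (_ * _); rewrite sign_card_big_symdiff -big_split /=.
  apply: eq_big_seq => a aN; rewrite /pair_sign upd_same upd_other ?exprD //.
  by apply: contraNneq vN => av; rewrite -/v -av.
(* The bound 2 / rho * D is a relative deficit, so it has mean at most 2 eps
   without any bound on the exponent. *)
rewrite meanE limE -family_meanZ -family_meanB.
apply: (le_trans (family_mean_norm rrn _)).
pose D x : R := (total_size N)%:R - #|big_symdiff N x|%:R.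
pose rho : R := (total_size N)%:R.
have rho0 : 0 <= rho by [].
apply: (@le_trans _ _ (family_mean rr (fun x => 20 * eps + 2 / rho * D x))).
  apply: (family_mean_le rrn) => x sx.
  rewrite -mulrBl normrM w1 mulr1 -mulrBr normrM sgn1 mul1r.
  have We := card_big_symdiff_le N sx.
  have Wn : (#|big_symdiff N x| <= n)%N by rewrite -[leqRHS]card_ord max_card.
  have epsn : eps * n%:R = (rr v)%:R + rho by rewrite /eps mulfVK ?gt_eqF // natrD.
  have r0 : 0 <= (rr v)%:R :> R by [].
  have Wr : #|big_symdiff N x|%:R <= rho :> R by rewrite ler_nat.
  have := @krawtchouk_approx R n #|big_symdiff N x| (rr v) eps e0 e16 n0 Wn.
  rewrite epsn => /(_ ltac:(lra) ltac:(lra)).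
  set Y := expR _ => KY.
  rewrite -/(K x) in KY *.
  suff XY : `|Y - X| <= 2 / rho * D x.
    by apply: (le_trans (ler_distD Y _ _)); lra.
  have D0 : 0 <= D x by rewrite /D; lra.
  pose s : R := 2 * (rr v)%:R / n%:R.
  have s0 : 0 <= s by rewrite /s divr_ge0 ?mulr_ge0.
  have XE : X = expR (- (s * rho)) by rewrite /X /s; congr expR; rewrite /rho; ring.
  have YE : Y = expR (- (s * #|big_symdiff N x|%:R)) by rewrite /Y /s; congr expR; ring.
  (* When the exponent is 0, one cannot divide by it, but both sides agree. *)
  have [sr|sr] := eqVneq (s * rho) 0.
    have -> : Y = X.
      rewrite YE XE sr; congr (expR (- _)); apply/eqP; rewrite eq_le.
      by rewrite mulr_ge0 // -sr ler_wpM2l.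
    by rewrite subrr normr0 mulr_ge0 // divr_ge0.
  have sr0 : 0 < s * rho by rewrite lt_def sr mulr_ge0.
  have rho1 : 0 < rho by rewrite lt_def rho0 andbT; apply: contraNneq sr => ->; rewrite mulr0.
  rewrite -(ler_pM2l sr0) XE YE; apply: (le_trans (expRN_dist _ _)).
  - by rewrite mulr_ge0.
  - by rewrite ler_wpM2l.
  rewrite le_eqVlt; apply/orP; left; apply/eqP.
  by rewrite /D -/rho; field; rewrite gt_eqF.
rewrite family_meanD family_mean_const // family_meanZ.
suff : 2 / rho * family_mean rr D <= 2 * eps by lra.
have def := big_symdiff_deficit uN; rewrite -/rho -/D in def.
have epsn : eps * n%:R = (rr v)%:R + rho by rewrite /eps mulfVK ?gt_eqF // natrD.
have r0 : 0 <= (rr v)%:R :> R by [].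
have [->|rho1] := eqVneq rho 0; first by rewrite invr0 mulr0 mul0r mulr_ge0.
have {}rho1 : 0 < rho by rewrite lt_def rho1.
rewrite mulrAC ler_pdivrMr // -(ler_pM2l N0).
have -> : n%:R * (2 * eps * rho) = 2 * (eps * n%:R) * rho by ring.
rewrite epsn; nra.
Qed.
End FamilySigns.

Section Pairings.
Variables (I L : eqType) (k : L -> I).
Implicit Types (u s : seq L).

(** All ways to complete a partial pair partition: [u] is the stack of the
    letters that are still open, the most recent one first, and [s] is the list
    of the letters to be read. Reading a letter either opens a block or closes
    the block of an open letter with the same label. *)
Fixpoint pairings u s : seq (seq (L * L * seq L)) :=
  match s with
  | [::] => if u is [::] then [:: [::]] else [::]
  | m :: s' =>
      pairings (m :: u) s' ++
      flatten [seq [seq (m, nth m u j, take j u) :: p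
                   | p <- pairings (remove_at j u) s']
              | j <- iota 0 (size u) & k m == k (nth m u j)]
  end.

Lemma big_pairings_cons (C : pzRingType) (F : seq (L * L * seq L) -> C) u m s :
  \sum_(p <- pairings u (m :: s)) F p =
  \sum_(p <- pairings (m :: u) s) F p +
  \sum_(j < size u | k m == k (nth m u j))
    \sum_(p <- pairings (remove_at j u) s) F ((m, nth m u j, take j u) :: p).
Proof.
rewrite /= big_cat /=; congr (_ + _).
rewrite big_flatten big_map big_filter -{1}[size u]subn0 big_mkord.
by apply: eq_bigr => j _; rewrite big_map.
Qed.

Lemma remove_atE u j m : (j < size u)%N ->
  u = take j u ++ nth m u j :: drop j.+1 u.
Proof. by move=> ju; rewrite -drop_nth // cat_take_drop. Qed.

Lemma pairings_matched u s p : p \in pairings u s -> {in p, forall t, k t.1.1 = k t.1.2}.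
Proof.
elim: s u p => [|m s IH] u p /=.
  by case: u => //; rewrite inE => /eqP->.
rewrite mem_cat => /orP[/IH//|/flattenP[ps /mapP[j]]].
rewrite mem_filter => /andP[/eqP kj _] -> /mapP[p' /IH p'P ->] t.
by rewrite inE => /orP[/eqP->//|/p'P].
Qed.

Lemma pairings_labels u s p t : p \in pairings u s -> t \in p ->
  (t.1.1 \in s) /\ {subset star_labels t <= u ++ s}.
Proof.
elim: s u p => [|m s IH] u p /=.
  by case: u => //; rewrite inE => /eqP->.
rewrite mem_cat => /orP[pP tp|/flattenP[ps /mapP[j]]].
  have [ts tsub] := IH _ _ pP tp; rewrite inE ts orbT; split=> // a /tsub.
  by rewrite !mem_cat !inE; case: (a == m); case: (a \in u).
rewrite mem_filter mem_iota add0n => /andP[_ /= ju] -> /mapP[p' pP ->].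
rewrite inE => /orP[/eqP->|tp] /=.
  rewrite eqxx; split=> // a; rewrite !inE mem_cat inE => /or3P[->|/eqP->|au].
  - by rewrite orbT.
  - by rewrite mem_nth.
  - by rewrite (mem_take au).
have [ts tsub] := IH _ _ pP tp; rewrite ts orbT; split=> // a /tsub.
rewrite !mem_cat !inE => /orP[/orP[au|au]|->]; last by rewrite !orbT.
  by rewrite (mem_take au).
by rewrite (mem_drop au).
Qed.

(** A closed block leaves the stack, so neither of its letters is met again,
    and the letters in [N] were read before any later closing letter. *)
Lemma pairings_wf u s p : uniq (u ++ s) -> p \in pairings u s -> well_formed p.
Proof.
elim: s u p => [|m s IH] u p /=.
  by case: u => // _; rewrite inE => /eqP->.
move=> us; rewrite mem_cat => /orP[|/flattenP[ps /mapP[j]]].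
  by apply: IH; move: us; rewrite -cat1s uniq_catCA.
rewrite mem_filter mem_iota add0n => /andP[_ /= ju] -> /mapP[p' pP ->] /=.
have uE := remove_atE m ju.
move: us pP; rewrite /remove_at; set v := nth m u j in uE *.
move: uE; set N := take j u; set N' := drop j.+1 u => -> us pP.
have /perm_uniq us' : perm_eq ((N ++ v :: N') ++ m :: s) (m :: v :: (N ++ N') ++ s).
  apply/permP => a; rewrite !count_cat /= !count_cat; lia.
rewrite us' /= in us; move/and3P: us => [mv vNs uNs].
rewrite !inE !mem_cat !negb_or in mv vNs.
move: mv vNs => /and3P[mv /andP[mN mN'] ms] /andP[/andP[vN vN'] vs].
apply/and5P; split=> //.
- by rewrite eq_sym.
- by move: uNs; rewrite !cat_uniq => /and3P[/and3P[]].
apply/andP; split; last exact: (IH _ _ uNs pP).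
apply/allP => t tp; have [ts tsub] := pairings_labels pP tp.
apply/and3P; split.
- by apply/negP => /tsub; rewrite !mem_cat (negbTE mN) (negbTE mN') (negbTE ms).
- by apply/negP => /tsub; rewrite !mem_cat (negbTE vN) (negbTE vN') (negbTE vs).
- apply/negP => tN; move: uNs; rewrite cat_uniq => /and3P[_ /hasPn/(_ _ ts)].
  by rewrite /= mem_cat tN.
Qed.
End Pairings.

(** * Vacuum moments of the q-Gaussian operators *)

Section Fock.
Variables (R : realType) (I : choiceType) (q : I -> I -> R).
Implicit Types (v : fock R I) (w : seq I).
Local Notation "v @_ w" := (monalg.mcoeff w v) (at level 3).

Lemma fock_ext_word (f : seq I -> fock R I) w : fock_ext f (fock_word R w) = f w.
Proof.
rewrite /fock_ext /fock_word monalg.msuppU oner_eq0 finmap.big_seq_fset1.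
by rewrite monalg.mcoeffUU scale1r.
Qed.

Lemma fock_ext_dom (f : seq I -> fock R I) v (D : finmap.finSet (seq I)) :
  finmap.fsubset (monalg.msupp v) D ->
  fock_ext f v = \sum_(w <- D) v @_ w *: f w.
Proof.
move=> vD; apply: finmap.big_fset_incl => // w _.
by rewrite -monalg.mcoeff_eq0 => /eqP->; rewrite scale0r.
Qed.

Lemma fock_extD (f : seq I -> fock R I) v v' :
  fock_ext f (v + v') = fock_ext f v + fock_ext f v'.
Proof.
pose D := finmap.fsetU (monalg.msupp v) (monalg.msupp v').
rewrite (@fock_ext_dom _ v D) ?finmap.fsubsetUl //.
rewrite (@fock_ext_dom _ v' D) ?finmap.fsubsetUr //.
rewrite (@fock_ext_dom _ (v + v') D) ?monalg.msuppD_le // -big_split.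
by apply: eq_bigr => w _; rewrite monalg.mcoeffD scalerDl.
Qed.

Lemma fock_extZ (f : seq I -> fock R I) c v :
  fock_ext f (c *: v) = c *: fock_ext f v.
Proof.
rewrite (@fock_ext_dom _ (c *: v) (monalg.msupp v)) ?monalg.msuppZ_le //.
rewrite /fock_ext scaler_sumr.
by apply: eq_bigr => w _; rewrite monalg.mcoeffZ scalerA.
Qed.

Lemma qgaussD i v v' : qgauss q i (v + v') = qgauss q i v + qgauss q i v'.
Proof.
have cE : creation i (v + v') = creation i v + creation i v'.
  exact: fock_extD.
have aE : annihilation q i (v + v') = annihilation q i v + annihilation q i v'.
  exact: fock_extD.
rewrite /qgauss cE aE.
exact: addrACA.
Qed.

Lemma qgaussZ i c v : qgauss q i (c *: v) = c *: qgauss q i v.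
Proof.
have cE : creation i (c *: v) = c *: creation i v by exact: fock_extZ.
have aE : annihilation q i (c *: v) = c *: annihilation q i v.
  exact: fock_extZ.
rewrite /qgauss cE aE; apply: esym.
exact: scalerDr.
Qed.

Lemma qgauss_word i w : qgauss q i (fock_word R w) =
  fock_word R (i :: w) +
  \sum_(j < size w) ((i == nth i w j)%:R * \prod_(a <- take j w) q i a)%:C *:
      fock_word R (remove_at j w).
Proof. by rewrite /qgauss /creation /annihilation !fock_ext_word. Qed.

(** Tensors of different lengths are orthogonal, so pairing with the vacuum
    extracts the coefficient of the empty word. *)
Lemma vacuum_stateE (a : fock R I -> fock R I) :
  vacuum_state q a = (a (vacuum R I)) @_ [::].
Proof.
rewrite /vacuum_state /fock_form; move: (a _) => v.
rewrite [RHS](_ : _ = \sum_(w <- monalg.msupp v) (v @_ w * (w == [::])%:R)).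
  apply: eq_bigr => w _.
  rewrite /vacuum /fock_word monalg.msuppU oner_eq0 finmap.big_seq_fset1.
  rewrite monalg.mcoeffUU rmorph1 mulr1; congr (_ * _).
  by case: w => [|i w] /=; rewrite ?big_ord0.
have [v0|v0] := eqVneq v @_ [::] 0.
  rewrite v0 big1 // => w _; case: eqP => [->|]; by rewrite ?v0 ?mul0r ?mulr0.
rewrite (bigD1_seq [::]) /= ?finmap.fset_uniq //; last by rewrite -monalg.mcoeff_neq0.
by rewrite mulr1 big1 ?addr0 // => w /negbTE->; rewrite mulr0.
Qed.

Section PairingExpansion.
Variables (L : eqType) (k : L -> I).

Definition apply_letters (s : seq L) v := foldl (fun v' m => qgauss q (k m) v') v s.

Lemma apply_letters_cons m s v :
  apply_letters (m :: s) v = apply_letters s (qgauss q (k m) v).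
Proof. by []. Qed.

Lemma apply_lettersD s v v' :
  apply_letters s (v + v') = apply_letters s v + apply_letters s v'.
Proof.
elim: s v v' => [//|m s IH] v v'.
by rewrite !apply_letters_cons qgaussD; exact: IH.
Qed.

Lemma apply_lettersZ s c v : apply_letters s (c *: v) = c *: apply_letters s v.
Proof.
elim: s v => [//|m s IH] v.
by rewrite !apply_letters_cons qgaussZ; exact: IH.
Qed.

Lemma apply_letters0 s : apply_letters s 0 = 0.
Proof. by have := apply_lettersZ s 0 0; rewrite !scale0r. Qed.

Lemma apply_letters_sum s (J : Type) (r : seq J) (F : J -> fock R I) :
  apply_letters s (\sum_(j <- r) F j) = \sum_(j <- r) apply_letters s (F j).
Proof.
elim: r => [|j r IH]; first by rewrite !big_nil apply_letters0.
by rewrite !big_cons apply_lettersD IH.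
Qed.

(** The word in the Fock space is the stack of open letters: creation pushes
    the letter, and annihilation removes an entry with the factors q of the
    entries in front of it, which is the recursion of [pairings]. *)
Lemma vacuum_coef_pairings (u s : seq L) :
  (apply_letters s (fock_word R (map k u))) @_ [::] =
  (\sum_(p <- pairings k u s) star_weight (fun a b => q (k a) (k b)) p)%:C.
Proof.
elim: s u => [|m s IH] u.
  rewrite /= monalg.mcoeffU; case: u => [|a u] /=; last by rewrite big_nil rmorph0.
  by rewrite big_seq1 /star_weight big_nil rmorph1.
rewrite apply_letters_cons qgauss_word big_pairings_cons rmorphD.
rewrite -[X in _ = X + _]IH apply_lettersD monalg.mcoeffD; congr (_ + _).
rewrite apply_letters_sum raddf_sum size_map [RHS]rmorph_sum [RHS]big_mkcond /=.
apply: eq_bigr => j _.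
rewrite apply_lettersZ monalg.mcoeffZ (nth_map m) // -map_take big_map.
rewrite (_ : remove_at j (map k u) = map k (remove_at j u)); last first.
  by rewrite /remove_at map_cat map_take map_drop.
rewrite IH; case: eqP => [kj|_]; last by rewrite mul0r rmorph0 mul0r.
rewrite mul1r -rmorphM mulr_sumr; congr _%:C.
by apply: eq_bigr => p _; rewrite star_weight_cons /= kj.
Qed.
End PairingExpansion.

Lemma big_comp_foldr (T J : Type) (r : seq J) (F : J -> T -> T) (z : T) :
  (\big[comp/id]_(m <- r) F m) z = foldr F z r.
Proof. by elim: r => [|m r IH]; rewrite ?big_nil // big_cons /= IH. Qed.

(** The rightmost operator acts first, so the letters are read from right to
    left. *)
Theorem vacuum_state_pairings d (k : 'I_d -> I) :
  vacuum_state q (\big[comp/id]_(m < d) qgauss q (k m)) =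
  (\sum_(p <- pairings k [::] (rev (enum 'I_d)))
     star_weight (fun a b => q (k a) (k b)) p)%:C.
Proof.
rewrite vacuum_stateE -(vacuum_coef_pairings k [::]); congr (_ @_ _).
by rewrite big_comp_foldr /apply_letters foldl_rev enumT.
Qed.
End Fock.

(** * Expectation of a product of independent variables *)

Section Independence.
Local Open Scope classical_set_scope.
Local Open Scope ring_scope.
Context d (T : measurableType d) (R : realType) (P : probability T R).

Import HBNNSimple.

(** The hypothesis on indicators extends to simple functions by linearity and
    to nonnegative functions by monotone convergence. *)
Lemma integral_mul_comp (h X : T -> R) (c : R) :
  measurable_fun setT h -> (forall w, 0 <= h w) -> measurable_fun setT X ->
  0 <= c ->
  (forall B, measurable B ->
     (\int[P]_w (h w * \1_B (X w))%:E = c%:E * P (X @^-1` B))%E) ->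
  forall g : R -> R, measurable_fun setT g -> (forall y, 0 <= g y) ->
  (\int[P]_w (h w * g (X w))%:E = c%:E * \int[P]_w (g (X w))%:E)%E.
Proof.
move=> mh h0 mX c0 hB g mg g0.
have mB (B : set R) : measurable B -> measurable (X @^-1` B).
  by move=> mB; rewrite -[X @^-1` B]setTI; exact: mX.
have simple (s : {nnsfun R >-> R}) :
    (\int[P]_w (h w * s (X w))%:E = c%:E * \int[P]_w (s (X w))%:E)%E.
  set r := fset_set (s @` setT).
  pose E (i : nat) := s @^-1` [set (nth 0 r i)].
  have mE i : measurable (E i) by exact: measurable_sfunP.
  have r0 i : (i < size r)%N -> 0 <= nth 0 r i.
    move=> ir; have : nth 0 r i \in r by rewrite mem_nth.
    by rewrite in_fset_set // inE => -[y _ <-].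
  have sE y : s y = \sum_(i < size r) (nth 0 r i * \1_(E i) y).
    by rewrite fimfunEord.
  have m1 i : measurable_fun setT (fun w => \1_(E i) (X w) : R).
    rewrite (_ : (fun w => _) = \1_(X @^-1` E i)) //.
    by apply: measurable_indic; apply: mB.
  transitivity (\sum_(i < size r) \int[P]_w ((nth 0 r i)%:E * (h w * \1_(E i) (X w))%:E))%E.
    rewrite -ge0_integral_sum //; last 2 first.
    - move=> i; apply/measurable_EFinP; apply: measurable_funM => //.
      exact: measurable_funM.
    - by move=> i w _; rewrite lee_fin !mulr_ge0 // r0.
    apply: eq_integral => w _; rewrite sE mulr_sumr -sumEFin.
    by apply: eq_bigr => i _; rewrite -EFinM mulrCA.
  transitivity (c%:E * \sum_(i < size r) \int[P]_w ((nth 0 r i)%:E * (\1_(E i) (X w))%:E))%E; last first.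
    congr (_ * _)%E; rewrite -ge0_integral_sum //; last 2 first.
    - move=> i; apply/measurable_EFinP; exact: measurable_funM.
    - by move=> i w _; rewrite lee_fin !mulr_ge0 // r0.
    by apply: eq_integral => w _; rewrite sE -sumEFin.
  rewrite ge0_sume_distrr; last first.
    by move=> i _; apply: integral_ge0 => w _; rewrite -EFinM lee_fin mulr_ge0 // r0.
  apply: eq_bigr => i _.
  rewrite !ge0_integralZl_EFin ?r0 //.
  - rewrite hB // muleCA; congr (_ * (_ * _))%E.
    rewrite (_ : (fun w => _) = (fun w => (\1_(X @^-1` E i) w)%:E)) //.
    by rewrite integral_indic ?setIT //; apply: mB.
  - exact/measurable_EFinP.
  - by move=> w _; rewrite lee_fin mulr_ge0.
  - by apply/measurable_EFinP; exact: measurable_funM.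
have mgE : measurable_fun setT (EFin \o g) by exact/measurable_EFinP.
pose a := nnsfun_approx measurableT mgE.
have mcomp n : measurable_fun setT (fun w => a n (X w)).
  exact: (measurableT_comp (measurable_funPT (a n)) mX).
have a0 n y : 0 <= a n y by exact: fun_ge0.
have ag w : ((a n (X w))%:E @[n --> \oo] --> (g (X w))%:E)%E.
  by apply: (@cvg_nnsfun_approx _ _ _ _ _ (EFin \o g) mgE) => // y _; rewrite lee_fin.
have nda w : {homo (fun n => a n (X w)) : n m / (n <= m)%N >-> n <= m}.
  by move=> m n mn; exact/lefP/nd_nnsfun_approx.
have L1 : (\int[P]_w (h w * a n (X w))%:E @[n --> \oo] --> \int[P]_w (h w * g (X w))%:E)%E.
  have -> : (\int[P]_w (h w * g (X w))%:E = \int[P]_w limn (fun n => (h w * a n (X w))%:E))%E.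
    apply: eq_integral => w _; apply/esym/cvg_lim => //.
    under eq_fun do rewrite EFinM.
    by rewrite EFinM; apply: cvgeZl.
  apply: cvg_monotone_convergence => //.
  - by move=> n; apply/measurable_EFinP; exact: measurable_funM.
  - by move=> n w _; rewrite lee_fin mulr_ge0.
  - by move=> w _ m n mn; rewrite lee_fin ler_wpM2l // nda.
have L2 : (\int[P]_w (a n (X w))%:E @[n --> \oo] --> \int[P]_w (g (X w))%:E)%E.
  have -> : (\int[P]_w (g (X w))%:E = \int[P]_w limn (fun n => (a n (X w))%:E))%E.
    by apply: eq_integral => w _; apply/esym/cvg_lim.
  apply: cvg_monotone_convergence => //.
  - by move=> n; exact/measurable_EFinP.
  - by move=> n w _; rewrite lee_fin.
  - by move=> w _ m n mn; rewrite lee_fin nda.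
have L3 : (\int[P]_w (h w * a n (X w))%:E @[n --> \oo] --> c%:E * \int[P]_w (g (X w))%:E)%E.
  by under eq_fun do rewrite simple; apply: cvgeZl.
by rewrite -(cvg_lim _ L1) // -(cvg_lim _ L3).
Qed.

Section ProductExpectation.
Variables (K : eqType) (D : set K) (X : K -> T -> R).
Hypothesis mX : forall i, measurable_fun setT (X i).
Hypothesis indX : mutually_independent P D X.
Implicit Types (s : seq K) (f : K -> R -> R) (B : K -> set R).

Let mXB i (B0 : set R) : measurable B0 -> measurable (X i @^-1` B0).
Proof. by move=> mB; rewrite -[X i @^-1` _]setTI; exact: mX. Qed.

(** Independence speaks of indicators. They are replaced by nonnegative
    functions one variable at a time: the variables of [s1] already carry
    general functions while those of [s2] still carry indicators, which
    provides the hypothesis of [integral_mul_comp] for the next variable. *)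
Lemma independent_nonneg (s1 s2 : seq K) f B :
  uniq (s1 ++ s2) -> [set` s1 ++ s2] `<=` D ->
  (forall i, measurable_fun setT (f i)) ->
  {in s1, forall i y, 0 <= f i y} ->
  {in s1, forall i, (\int[P]_w (f i (X i w))%:E < +oo)%E} ->
  (forall i, measurable (B i)) ->
  (\int[P]_w ((\prod_(i <- s1) f i (X i w)) * \prod_(i <- s2) \1_(B i) (X i w))%:E
   = (\prod_(i <- s1) fine (\int[P]_w (f i (X i w))%:E)
      * \prod_(i <- s2) fine (P (X i @^-1` B i)))%:E)%E.
Proof.
elim: s1 s2 B => [|a s1 IH] s2 B us sD mf f0 ffin mB.
  have EI w : (\prod_(i <- s2) \1_(B i) (X i w))%R =
      \1_(\bigcap_(i in [set` s2]) (X i @^-1` B i)) w :> R.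
    rewrite indicE; case: (boolP (_ \in _)); rewrite ?inE ?notin_setE.
      move=> h; rewrite big_seq big1 // => i is2.
      by rewrite indicE mem_set //; exact: h.
    rewrite /= => h; apply/eqP; rewrite prodf_seq_eq0; apply: contrapT => /negP.
    rewrite -all_predC => /allP h2; apply: h => i /= is2.
    have := h2 i is2; rewrite /= indicE.
    by case: (boolP (_ \in _)) => [/set_mem//|_]; rewrite eqxx.
  under eq_integral do rewrite big_nil mul1r EI.
  rewrite integral_indic //; last first.
    by apply: fin_bigcap_measurable => // i _; exact: mXB.
  rewrite classical_sets.setIT big_nil mul1r.
  transitivity (\prod_(i <- s2) P (X i @^-1` B i))%E; first exact: indX.
  elim: (s2) => [|b s' IHs]; first by rewrite !big_nil.
  rewrite !big_cons IHs EFinM; congr (_ * _)%E.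
  by rewrite fineK //; apply: fin_num_measure; exact: mXB.
have us2 : uniq (s1 ++ a :: s2) by move: us; rewrite -[a :: s2]cat1s uniq_catCA.
have sD2 : [set` s1 ++ a :: s2] `<=` D.
  move=> i /=; rewrite mem_cat inE => ii; apply: sD => /=.
  by rewrite !inE mem_cat; move: ii; case: (i == a); case: (i \in s1).
have f0' : {in s1, forall i y, 0 <= f i y}.
  by move=> i is1; apply: f0; rewrite inE is1 orbT.
have ffin' : {in s1, forall i, (\int[P]_w (f i (X i w))%:E < +oo)%E}.
  by move=> i is1; apply: ffin; rewrite inE is1 orbT.
have as12 : a \notin s1 ++ s2 by move: us => /= /andP[].
have as2 : a \notin s2 by move: as12; rewrite mem_cat negb_or => /andP[].
pose h w := (\prod_(i <- s1) f i (X i w)) * \prod_(i <- s2) \1_(B i) (X i w).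
pose c := \prod_(i <- s1) fine (\int[P]_w (f i (X i w))%:E)
      * \prod_(i <- s2) fine (P (X i @^-1` B i)).
have key (B0 : set R) : measurable B0 ->
    (\int[P]_w (h w * \1_B0 (X a w))%:E = c%:E * P (X a @^-1` B0))%E.
  move=> mB0; pose B' i := if i == a then B0 else B i.
  have B'E i : i \in s2 -> B' i = B i.
    by rewrite /B'; case: eqP => // -> as2'; rewrite as2' in as2.
  have mB' i : measurable (B' i) by rewrite /B'; case: ifP.
  have B'a : B' a = B0 by rewrite /B' eqxx.
  have := IH (a :: s2) B' us2 sD2 mf f0' ffin' mB'.
  rewrite big_cons B'a.
  rewrite [X in (_ * (_ * X))%:E](eq_big_seq (fun i => fine (P (X i @^-1` B i)))); last first.
    by move=> i /B'E ->.
  move=> E.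
  transitivity (\int[P]_w (\prod_(i <- s1) f i (X i w)
                           * \prod_(i <- a :: s2) \1_(B' i) (X i w))%:E)%E.
    apply: eq_integral => w _; congr (_%:E); rewrite big_cons B'a /h -mulrA.
    congr (_ * _); rewrite mulrC; congr (_ * _); apply: eq_big_seq => i /B'E->//.
  rewrite E /c -[X in (_ * X)%E]fineK; last by apply: fin_num_measure; exact: mXB.
  by rewrite -EFinM; congr (_%:E); ring.
have h0 w : 0 <= h w.
  rewrite mulr_ge0 //; last by apply: prodr_ge0 => i _; rewrite indicE.
  by rewrite big_seq; apply: prodr_ge0 => i is1; exact: f0'.
have c0 : 0 <= c.
  rewrite mulr_ge0 //; last by apply: prodr_ge0 => i _; rewrite fine_ge0.
  rewrite big_seq; apply: prodr_ge0 => i is1; rewrite fine_ge0 //.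
  by apply: integral_ge0 => w _; rewrite lee_fin f0'.
have mh : measurable_fun setT h.
  apply: measurable_funM; apply: measurable_prod => i _.
    exact: (measurableT_comp (mf i) (mX i)).
  rewrite (_ : (fun w => _) = \1_(X i @^-1` B i)) //.
  by apply: measurable_indic; apply: mXB.
transitivity (\int[P]_w (h w * f a (X a w))%:E)%E.
  by apply: eq_integral => w _; rewrite big_cons /h; congr (_%:E); ring.
rewrite (integral_mul_comp mh h0 (mX a) c0 key (mf a)); last first.
  by apply: f0; rewrite inE eqxx.
rewrite big_cons -[X in (_ * X)%E]fineK.
  by rewrite -EFinM /c; congr (_%:E); ring.
rewrite ge0_fin_numE; first by apply: ffin; rewrite inE eqxx.
by apply: integral_ge0 => w _; rewrite lee_fin; apply: f0; rewrite inE eqxx.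
Qed.

Let expect i (g : R -> R) : R := fine (\int[P]_w (g (X i w))%:E)%E.

(** The same scheme with [s2] still carrying nonnegative functions: each
    function moved to [s1] is split into its positive and negative parts. *)
Lemma independent_signed (s1 s2 : seq K) f :
  uniq (s1 ++ s2) -> [set` s1 ++ s2] `<=` D ->
  (forall i, measurable_fun setT (f i)) ->
  {in s2, forall i y, 0 <= f i y} ->
  {in s1 ++ s2, forall i, P.-integrable setT (fun w => (f i (X i w))%:E)} ->
  P.-integrable setT
    (fun w => ((\prod_(i <- s1) f i (X i w)) * \prod_(i <- s2) f i (X i w))%:E) /\
  (\int[P]_w ((\prod_(i <- s1) f i (X i w)) * \prod_(i <- s2) f i (X i w))%:E
   = (\prod_(i <- s1) expect i (f i) * \prod_(i <- s2) expect i (f i))%:E)%E.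
Proof.
elim: s1 s2 f => [|a s1 IH] s2 f us sD mf f0 fi.
  have ffin : {in s2, forall i, (\int[P]_w (f i (X i w))%:E < +oo)%E}.
    move=> i /fi /integrable_fin_num; rewrite fin_numE => /(_ measurableT) /andP[_].
    by rewrite ltey.
  have := @independent_nonneg s2 [::] f (fun=> setT).
  rewrite cats0 => /(_ us sD mf f0 ffin (fun=> measurableT)).
  under eq_integral do rewrite big_nil mulr1.
  rewrite !big_nil mulr1 => E.
  under eq_fun do rewrite big_nil mul1r.
  rewrite E mul1r; split=> //; apply/integrableP; split.
    apply/measurable_EFinP; apply: measurable_prod => i _.
    exact: (measurableT_comp (mf i) (mX i)).
  under eq_integral.
    move=> w _; rewrite abse_EFin ger0_norm; last first.
      by rewrite big_seq; apply: prodr_ge0 => i /f0.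
    over.
  by rewrite E ltry.
have us2 : uniq (s1 ++ a :: s2) by move: us; rewrite -[a :: s2]cat1s uniq_catCA.
have memE i : (i \in s1 ++ a :: s2) = (i \in (a :: s1) ++ s2).
  by rewrite !mem_cat !inE; case: (i == a); case: (i \in s1).
have sD2 : [set` s1 ++ a :: s2] `<=` D.
  by move=> i /=; rewrite memE => ii; apply: sD.
have as12 : a \notin s1 ++ s2 by move: us => /= /andP[].
have [as1 as2] : a \notin s1 /\ a \notin s2.
  by apply/andP; rewrite -negb_or -mem_cat.
pose rest w := (\prod_(i <- s1) f i (X i w)) * \prod_(i <- s2) f i (X i w).
pose upd_at (g : R -> R) i := if i == a then g else f i.
have updE g i : i != a -> upd_at g i = f i by rewrite /upd_at => /negbTE->.
have upd1 g i : i \in s1 -> upd_at g i = f i.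
  by move=> is1; apply: updE; apply: contraNneq as1 => <-.
have upd2 g i : i \in s2 -> upd_at g i = f i.
  by move=> is2; apply: updE; apply: contraNneq as2 => <-.
have upda g : upd_at g a = g by rewrite /upd_at eqxx.
have iA : P.-integrable setT (fun w => (f a (X a w))%:E).
  by apply: fi; rewrite inE eqxx.
have main (g : R -> R) : measurable_fun setT g -> (forall y, 0 <= g y) ->
    P.-integrable setT (fun w => (g (X a w))%:E) ->
    P.-integrable setT (fun w => (g (X a w) * rest w)%:E) /\
    (\int[P]_w (g (X a w) * rest w)%:E
      = (expect a g * (\prod_(i <- s1) expect i (f i) * \prod_(i <- s2) expect i (f i)))%:E)%E.
  move=> mg g0 ig.
  have := IH (a :: s2) (upd_at g) us2 sD2.
  have -> : (fun w => (\prod_(i <- s1) upd_at g i (X i w)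
                   * \prod_(i <- a :: s2) upd_at g i (X i w))%:E)
      = (fun w => (g (X a w) * rest w)%:E).
    apply/funext => w; congr (_%:E); rewrite /rest big_cons upda mulrCA; congr (_ * (_ * _)).
      by apply: eq_big_seq => i /upd1->.
    by apply: eq_big_seq => i /upd2->.
  rewrite big_cons upda mulrCA.
  rewrite (eq_big_seq (fun i => expect i (f i))); last by move=> i /upd1->.
  rewrite [\prod_(i <- s2) expect i (upd_at g i)](eq_big_seq (fun i => expect i (f i))); last first.
    by move=> i /upd2->.
  apply.
  - by move=> i; rewrite /upd_at; case: ifP.
  - by move=> i; rewrite inE => /orP[/eqP->|is2]; [rewrite upda|rewrite upd2 //; exact: f0].
  - move=> i ii; rewrite /upd_at; case: eqP => [->//|_].
    by apply: fi; rewrite -memE.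
have mp : measurable_fun setT (fun y => Num.max (f a y) 0).
  by apply: measurable_maxr => //; exact: measurable_cst.
have mm : measurable_fun setT (fun y => Num.max (- f a y) 0).
  by apply: measurable_maxr; [exact: measurableT_comp|exact: measurable_cst].
have ip : P.-integrable setT (fun w => (Num.max (f a (X a w)) 0)%:E).
  apply: (le_integrable _ _ _ iA) => //.
    by apply/measurable_EFinP; exact: (measurableT_comp mp (mX a)).
  by move=> w _; rewrite !abse_EFin lee_fin; case: (leP (f a (X a w)) 0) => ?; rewrite ?normr0.
have im : P.-integrable setT (fun w => (Num.max (- f a (X a w)) 0)%:E).
  apply: (le_integrable _ _ _ iA) => //.
    by apply/measurable_EFinP; exact: (measurableT_comp mm (mX a)).
  by move=> w _; rewrite !abse_EFin lee_fin; case: (leP (- f a (X a w)) 0) => ?;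
    rewrite ?normr0 ?normrN.
have maxB y : f a y = Num.max (f a y) 0 - Num.max (- f a y) 0.
  by case: (leP (f a y) 0) => ?; case: (leP (- f a y) 0) => ?; lra.
have [] := main _ mp _ ip; first by move=> y; rewrite le_max lexx orbT.
have [] := main _ mm _ im; first by move=> y; rewrite le_max lexx orbT.
move=> i2 E2 i1 E1.
have eA : expect a (f a) = expect a (fun y => Num.max (f a y) 0)
    - expect a (fun y => Num.max (- f a y) 0).
  rewrite /expect -fineB ?integrable_fin_num //; congr fine.
  rewrite -integralB_EFin //; apply: eq_integral => w _.
  by rewrite -EFinB -maxB.
have -> : (fun w => (\prod_(i <- a :: s1) f i (X i w) * \prod_(i <- s2) f i (X i w))%:E)
  = (fun w => (Num.max (f a (X a w)) 0 * rest w)%:E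
   - (Num.max (- f a (X a w)) 0 * rest w)%:E)%E.
  by apply/funext => w; rewrite -EFinB -mulrBl -maxB /rest big_cons mulrA.
split; first exact: integrableB.
rewrite integralB_EFin // E1 E2 -EFinB -mulrBl -eA big_cons.
by rewrite -mulrA.
Qed.

Theorem expectation_prod_independent s f :
  uniq s -> [set` s] `<=` D ->
  (forall i, measurable_fun setT (f i)) ->
  {in s, forall i, P.-integrable setT (fun w => (f i (X i w))%:E)} ->
  P.-integrable setT (fun w => (\prod_(i <- s) f i (X i w))%:E) /\
  ('E_P[fun w => (\prod_(i <- s) f i (X i w))%R] =
    (\prod_(i <- s) fine 'E_P[fun w => f i (X i w)])%R%:E)%E.
Proof.
move=> us sD mf fi.
have [] := @independent_signed s [::] f; rewrite ?cats0 //.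
under eq_fun do rewrite big_nil mulr1.
move=> ii E; split=> //; rewrite unlock E big_nil mulr1; congr (_%:E).
Qed.
End ProductExpectation.
End Independence.

(** * Monomials in anticommuting fermions *)

Section Majorana.
Variables (R : realType) (A : algType R[i]).

Section Clifford.
Variables (J : eqType) (phi : J -> A).
Hypothesis car : forall j k,
  phi j * phi k + phi k * phi j = ((j == k)%:R *+ 2)%:A.
Implicit Types s t : seq J.

Definition monomial s : A := \prod_(j <- s) phi j.

Lemma clifford_sqr j : phi j * phi j = 1.
Proof.
have := car j j; rewrite eqxx -mulr2n -scaler_nat => h.
have two : (2%:R : R[i]) != 0 by rewrite pnatr_eq0.
exact: (scalerI two).
Qed.

Lemma clifford_comm j k : phi j * phi k = (-1) ^+ (1 + (j == k)) *: (phi k * phi j).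
Proof.
have [->|jk] := eqVneq j k; first by rewrite expr2 mulrNN mulr1 scale1r.
have := car j k; rewrite (negbTE jk) mul0rn scale0r expr1 scaleN1r => /eqP.
by rewrite addr_eq0 => /eqP.
Qed.

Lemma monomial_cons j s : monomial (j :: s) = phi j * monomial s.
Proof. by rewrite /monomial big_cons. Qed.

Lemma monomial0 : monomial [::] = 1.
Proof. by rewrite /monomial big_nil. Qed.

(** Moving a fermion across a letter costs a sign, except across itself. *)
Lemma monomial_comm1 j t :
  phi j * monomial t = (-1) ^+ (size t + count_mem j t) *: (monomial t * phi j).
Proof.
elim: t => [|k t IH]; first by rewrite monomial0 mulr1 mul1r scale1r.
rewrite monomial_cons mulrA clifford_comm -scalerAl -[phi k * phi j * _]mulrA IH.
rewrite -scalerAr scalerA mulrA -exprD /= [k == j]eq_sym.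
by congr (_ ^+ _ *: _); lia.
Qed.

Lemma monomial_comm s t :
  monomial s * monomial t =
  (-1) ^+ (size s * size t + \sum_(j <- s) count_mem j t) *: (monomial t * monomial s).
Proof.
elim: s => [|j s IH].
  by rewrite monomial0 big_nil mulr1 mul1r scale1r.
rewrite monomial_cons big_cons -[LHS]mulrA IH -scalerAr.
rewrite [phi j * (_ * _)]mulrA monomial_comm1.
rewrite -scalerAl scalerA -mulrA -exprD.
by congr (_ ^+ _ *: _); rewrite /=; lia.
Qed.

Lemma monomial_sqr s : uniq s -> monomial s * monomial s = (-1) ^+ 'C(size s, 2) *: 1.
Proof.
elim: s => [|j s IH] /=; first by rewrite /monomial big_nil mulr1 scale1r.
move=> /andP[js us]; rewrite monomial_cons.
rewrite {1}monomial_comm1 (count_memPn js) addn0 -scalerAl -mulrA [phi j * (_ * _)]mulrA.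
by rewrite clifford_sqr mul1r IH // scalerA -exprD binS bin1 addnC.
Qed.
End Clifford.

Section Trace.
Variables (psi : nat -> A) (tr : A -> R[i]).
Hypothesis car : forall j k,
  psi j * psi k + psi k * psi j = ((j == k)%:R *+ 2)%:A.
Hypothesis htr : is_normalized_trace psi tr.

Lemma gen_alg0 : gen_alg psi 0.
Proof. by rewrite -(scale0r 1); apply: gen_algZ; exact: gen_alg1. Qed.

Lemma gen_alg_sum (K : Type) (r : seq K) (F : K -> A) :
  (forall i, gen_alg psi (F i)) -> gen_alg psi (\sum_(i <- r) F i).
Proof.
move=> gF; elim: r => [|i r IH]; first by rewrite big_nil; exact: gen_alg0.
by rewrite big_cons; apply: gen_algD.
Qed.

Lemma gen_alg_prod (K : Type) (r : seq K) (F : K -> A) :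
  (forall i, gen_alg psi (F i)) -> gen_alg psi (\prod_(i <- r) F i).
Proof.
move=> gF; elim: r => [|i r IH]; first by rewrite big_nil; exact: gen_alg1.
by rewrite big_cons; apply: gen_algM.
Qed.

Lemma trace0 : tr 0 = 0.
Proof.
have := trace_linear htr 1 gen_alg0 gen_alg0.
rewrite scale1r addr0 mul1r => /eqP.
by rewrite -[X in X == _]addr0 (inj_eq (addrI _)) eq_sym => /eqP.
Qed.

Lemma traceZ c a : gen_alg psi a -> tr (c *: a) = c * tr a.
Proof. by move=> ga; have := trace_linear htr c ga gen_alg0; rewrite trace0 !addr0. Qed.

Lemma trace_sum (K : Type) (r : seq K) (F : K -> A) :
  (forall i, gen_alg psi (F i)) -> tr (\sum_(i <- r) F i) = \sum_(i <- r) tr (F i).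
Proof.
move=> gF; elim: r => [|i r IH]; first by rewrite !big_nil trace0.
rewrite !big_cons -IH.
by have := trace_linear htr 1 (gF i) (gen_alg_sum r gF); rewrite scale1r mul1r.
Qed.

(** A fermion is moved to its place in an increasing word, or cancels the copy
    of itself which is already there. *)
Lemma monomial_insert j s : sorted ltn s ->
  exists b s', sorted ltn s' /\ psi j * monomial psi s = (-1) ^+ b *: monomial psi s'.
Proof.
move=> ss.
have [js|js] := boolP (j \in s).
  case/splitPr: js ss => s1 s2 ss.
  exists (size s1 + count_mem j s1)%N, (s1 ++ s2); split.
    apply: (subseq_sorted ltn_trans _ ss).
    by rewrite subseq_cat2l subseq_cons.
  rewrite /monomial !big_cat big_cons mulrA -/(monomial psi s1) (monomial_comm1 car).
  by rewrite -scalerAl -mulrA [psi j * (_ * _)]mulrA clifford_sqr // mul1r.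
have [s1 [s2 [sE h1 h2]]] : exists s1 s2, [/\ s = s1 ++ s2,
    all (fun i => i < j)%N s1 & all (fun i => j < i)%N s2].
  elim: s ss js => [|a s IH] /=; first by exists [::], [::].
  rewrite inE negb_or => ss /andP[ja js].
  have [aj|aj] := ltnP a j.
    have [s1 [s2 [-> h1 h2]]] := IH (path_sorted ss) js.
    by exists (a :: s1), s2; split=> //=; rewrite aj.
  have {}ja : (j < a)%N by rewrite ltn_neqAle ja.
  exists [::], (a :: s); split=> //=; rewrite ja.
  have := order_path_min ltn_trans ss.
  by apply: sub_all => i; apply: ltn_trans.
exists (size s1 + count_mem j s1)%N, (s1 ++ j :: s2); split.
  move: ss; rewrite sE !(sorted_pairwise ltn_trans) !pairwise_cat /=.
  move=> /and3P[a12 p1 p2]; rewrite p1 p2 h2 andbT /=.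
  rewrite allrel_consr a12 andbT; apply/andP; split=> //.
rewrite sE /monomial !big_cat big_cons mulrA -/(monomial psi s1) (monomial_comm1 car).
by rewrite -scalerAl -mulrA.
Qed.

Lemma monomial_normal_form s :
  exists b s', sorted ltn s' /\ monomial psi s = (-1) ^+ b *: monomial psi s'.
Proof.
elim: s => [|j s [b [s' [ss' E]]]].
  by exists 0%N, [::]; rewrite scale1r.
have [c [s'' [ss'' E']]] := monomial_insert j ss'.
exists (b + c)%N, s''; split=> //.
by rewrite monomial_cons E -scalerAr E' scalerA exprD.
Qed.

Lemma gen_alg_monomial s : gen_alg psi (monomial psi s).
Proof. by apply: gen_alg_prod => j; exact: gen_alg_psi. Qed.

(** Sorting reduces a monomial, up to sign, to 1 or to an increasing nonempty
    word, whose trace vanishes. *)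
Lemma trace_monomial_le1 s : `|tr (monomial psi s)| <= 1.
Proof.
have [b [s' [ss' ->]]] := monomial_normal_form s.
rewrite traceZ ?normrM; last exact: gen_alg_monomial.
rewrite normrX normrN1 expr1n mul1r.
have [->|s0] := eqVneq s' [::]; first by rewrite monomial0 (trace1 htr) normr1.
by rewrite (trace_psi htr ss' s0) normr0 ler01.
Qed.
End Trace.

Section NormalizedMonomials.
Variables (psi : nat -> A) (n : nat).
Hypothesis car : forall j k,
  psi j * psi k + psi k * psi j = ((j == k)%:R *+ 2)%:A.
Implicit Types S U : {set 'I_n}.

(** The phase is the one that makes the square equal to 1, see [Psi_sqr]. *)
Definition Psi S : A :=
  'i ^+ (#|S| %/ 2) *: monomial (fun j : 'I_n => psi j) (enum S).

Let carI (j k : 'I_n) :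
  psi j * psi k + psi k * psi j = ((j == k)%:R *+ 2)%:A.
Proof. exact: car. Qed.

Definition set_sign (C : pzRingType) S U : C := (-1) ^+ (#|S| * #|U| + #|S :&: U|).

Lemma Psi_comm S U : Psi S * Psi U = set_sign _ S U *: (Psi U * Psi S).
Proof.
rewrite /Psi -!scalerAl -!scalerAr !scalerA (monomial_comm carI) scalerA.
rewrite -!cardE /set_sign; congr (_ *: _).
rewrite mulrC -[RHS]mulrA; congr (_ ^+ (_ + _) * _); last exact: mulrC.
rewrite -sum1_card big_enum /= [RHS]big_mkcond [LHS]big_mkcond /=.
apply: eq_bigr => j _; rewrite finset.in_setI; case: (j \in S) => //=.
by rewrite count_uniq_mem ?enum_uniq // mem_enum; case: (j \in U).
Qed.

(** Reversing a word of length m takes 'C(m, 2) transpositions, and the square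
    of the phase is (-1)^(m %/ 2): the two signs cancel. The induction carries
    two consecutive values because its step goes from m to m + 2. *)
Lemma odd_half_bin2 m : odd (m %/ 2 + 'C(m, 2)) = false.
Proof.
suff /andP[/negbTE-> _] : ~~ odd (m %/ 2 + 'C(m, 2)) && ~~ odd (m.+1 %/ 2 + 'C(m.+1, 2)) by [].
elim: m => [//|m /andP[h1 h2]]; rewrite h2 /=.
rewrite 2!binS !bin1 -add2n divnDl // divnn /=.
by move: h1; rewrite add0n !oddD /=; case: odd; case: odd; case: odd.
Qed.

Lemma Psi_sqr S : Psi S * Psi S = 1.
Proof.
rewrite /Psi -scalerAl -scalerAr scalerA (monomial_sqr carI) ?enum_uniq //.
rewrite scalerA -expr2 exprAC.
rewrite (_ : ('i : R[i]) ^+ 2 = -1); last by rewrite sqrCi.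
by rewrite -exprD -cardE -signr_odd odd_half_bin2 scale1r.
Qed.

Lemma Psi_comm_prod (L : Type) (N : seq L) (x : L -> {set 'I_n}) S :
  Psi S * \prod_(a <- N) Psi (x a) =
  (\prod_(a <- N) set_sign _ S (x a)) *: (\prod_(a <- N) Psi (x a) * Psi S).
Proof.
elim: N => [|a N IH]; first by rewrite !big_nil mulr1 mul1r scale1r.
rewrite !big_cons mulrA Psi_comm -scalerAl -[Psi (x a) * Psi S * _]mulrA IH.
by rewrite -scalerAr scalerA mulrA.
Qed.

Lemma Psi_cancel (L : Type) (N : seq L) (x : L -> {set 'I_n}) S a :
  Psi S * (\prod_(b <- N) Psi (x b) * (Psi S * a)) =
  (\prod_(b <- N) set_sign _ S (x b)) *: (\prod_(b <- N) Psi (x b) * a).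
Proof.
rewrite mulrA Psi_comm_prod -scalerAl -mulrA; congr (_ *: (_ * _)).
by rewrite mulrA Psi_sqr mul1r.
Qed.

(** Reading the letters as in [pairings], the product of the open monomials
    plays the role of the stack. When [m] closes [v], the factor [Psi (x m)]
    is moved across the factors opened after [v] and cancels [Psi (x v)];
    this produces the commutation signs recorded in the star. *)
Lemma Psi_pairing (I L : eqType) (k : L -> I) (u s : seq L) p (x : L -> {set 'I_n}) :
  p \in pairings k u s -> {in p, forall t, x t.1.1 = x t.1.2} ->
  \prod_(m <- rev s) Psi (x m) * \prod_(a <- u) Psi (x a)
  = (star_weight (fun a b => set_sign _ (x a) (x b)) p)%:A.
Proof.
elim: s u p => [|m s IH] u p /=.
  case: u => // ; rewrite inE => /eqP-> _.
  by rewrite !big_nil /star_weight big_nil mulr1 scale1r.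
rewrite rev_cons big_rcons /= -mulrA mem_cat => /orP[pP xp|/flattenP[ps /mapP[j]]].
  by rewrite -(IH _ _ pP xp) big_cons.
rewrite mem_filter mem_iota add0n => /andP[_ /= ju] -> /mapP[p' pP ->] xp.
have xmv : x m = x (nth m u j) by apply: (xp (m, nth m u j, take j u)); rewrite inE eqxx.
rewrite {1}(remove_atE m ju) big_cat big_cons xmv Psi_cancel -scalerAr -big_cat.
rewrite star_weight_cons.
rewrite (IH (remove_at j u) p' pP) ?scalerA // => t tp.
by apply: xp; rewrite inE tp orbT.
Qed.
End NormalizedMonomials.

Lemma gen_alg_Psi (psi : nat -> A) n (S : {set 'I_n}) : gen_alg psi (Psi psi S).
Proof. by apply: gen_algZ; apply: gen_alg_prod => j; exact: gen_alg_psi. Qed.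

Lemma norm_trace_Psi_le1 (psi : nat -> A) (tr : A -> R[i]) n (L : Type)
    (s : seq L) (x : L -> {set 'I_n}) :
  (forall j k, psi j * psi k + psi k * psi j = ((j == k)%:R *+ 2)%:A) ->
  is_normalized_trace psi tr ->
  `|tr (\prod_(m <- s) Psi psi (x m))| <= 1.
Proof.
move=> car htr.
have [c [l [c1 ->]]] : exists (c : R[i]) (l : seq nat),
    `|c| = 1 /\ \prod_(m <- s) Psi psi (x m) = c *: monomial psi l.
  elim: s => [|m s [c [l [c1 E]]]].
    by exists 1, [::]; rewrite normr1 big_nil scale1r monomial0.
  exists ('i ^+ (#|x m| %/ 2) * c), ([seq val j | j <- enum (x m)] ++ l); split.
    by rewrite normrM c1 mulr1 normrX normCi expr1n.
  rewrite big_cons E /Psi -scalerAl -scalerAr scalerA; congr (_ *: _).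
  by rewrite /monomial big_cat big_map.
rewrite (traceZ htr) ?normrM ?c1 ?mul1r; first exact: trace_monomial_le1.
exact: gen_alg_monomial.
Qed.
End Majorana.

(** * Counting the matching pair partitions *)

Section WickCount.
Variables (R : realType) (L K H : eqType) (k : L -> K) (x : L -> H).
Implicit Types (u s : seq L).

Definition compatible (p : seq (L * L * seq L)) : bool :=
  all (fun t => x t.1.1 == x t.1.2) p.

(** The number of pair partitions whose blocks join letters with equal labels
    and equal sets, hence with the same random coefficient. *)
Definition wick u s : R := \sum_(p <- pairings k u s) (compatible p)%:R.

Let y m := (k m, x m).
Definition multiplicity u (z : K * H) := count (fun m => (k m, x m) == z) u.

Lemma wick_cons u m s :
  wick u (m :: s) = wick (m :: u) s
    + \sum_(j < size u | y m == y (nth m u j)) wick (remove_at j u) s.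
Proof.
rewrite /wick big_pairings_cons; congr (_ + _).
rewrite [LHS]big_mkcond [RHS]big_mkcond /=; apply: eq_bigr => j _.
rewrite xpair_eqE; case: eqP => //= _; case: eqP => [xmj|xmj] /=; first by [].
by rewrite big1.
Qed.

Lemma multiplicity_cons u m z :
  multiplicity (m :: u) z = ((y m == z) + multiplicity u z)%N.
Proof. by []. Qed.

Lemma multiplicity_remove u m j z : (j < size u)%N ->
  multiplicity u z = ((y (nth m u j) == z) + multiplicity (remove_at j u) z)%N.
Proof.
move=> ju; rewrite {1}(remove_atE m ju) /multiplicity /remove_at !count_cat /=.
by rewrite addnCA.
Qed.

(** A value that occurs once cannot be paired. For the induction one also needs
    the case of more open letters with this value than letters to come. *)
Lemma wick_eq0 u s z :
  (multiplicity s z < multiplicity u z)%N || (multiplicity u z + multiplicity s z == 1)%N ->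
  wick u s = 0.
Proof.
elim: s u => [|m s IH] u.
  by case: u => [|a u]; rewrite ?orbF // /wick big_nil.
rewrite multiplicity_cons => h; rewrite wick_cons IH ?add0r.
  rewrite big1 // => j /eqP yj; apply: IH.
  by move: h; rewrite (multiplicity_remove m z (ltn_ord j)) -yj; case: eqP => _; lia.
by rewrite multiplicity_cons; move: h; case: eqP => _; lia.
Qed.

(** If each value occurs exactly twice, the pairing is forced: its first
    occurrence opens a block and its second one closes it. The pair (1, 1)
    describes a value that is open and waits for its second occurrence. *)
Lemma wick_eq1 u s :
  (forall z, (multiplicity u z, multiplicity s z) \in [:: (0, 0); (0, 2); (1, 1)]%N) ->
  wick u s = 1.
Proof.
elim: s u => [|m s IH] u h.
  case: u h => [_|a u /(_ (y a))]; first by rewrite /wick big_seq1.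
  by rewrite multiplicity_cons eqxx add1n /multiplicity /= !inE !xpair_eqE /= andbF.
rewrite wick_cons.
have hm := h (y m); rewrite multiplicity_cons eqxx add1n in hm.
have [u0|u0] := eqVneq (multiplicity u (y m)) 0%N.
  rewrite big_pred0 ?addr0.
    apply: IH => z; have := h z; rewrite !multiplicity_cons.
    case: eqP => [<-|_]; rewrite ?add0n ?add1n //.
    by rewrite u0 !inE !xpair_eqE; lia.
  move=> j; apply/negP => /eqP yj; move: u0.
  by rewrite (multiplicity_remove m _ (ltn_ord j)) yj eqxx.
have [u1 s0] : multiplicity u (y m) = 1%N /\ multiplicity s (y m) = 0%N.
  by move: hm u0; rewrite !inE !xpair_eqE; lia.
rewrite (@wick_eq0 _ _ (y m)) ?add0r; last first.
  by rewrite s0 multiplicity_cons eqxx.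
have -> : \sum_(j < size u | y m == y (nth m u j)) wick (remove_at j u) s
    = (\sum_(j < size u | y m == y (nth m u j)) 1)%N%:R.
  rewrite natr_sum; apply: eq_bigr => j /eqP yj; apply: IH => z.
  have := h z; rewrite (multiplicity_remove m z (ltn_ord j)) multiplicity_cons -yj.
  case: eqP => [<-|_]; rewrite ?add0n ?add1n // => _.
  by move: u1; rewrite (multiplicity_remove m _ (ltn_ord j)) -yj eqxx add1n s0 => -[->].
rewrite -[RHS]/(1%:R) -[in RHS]u1 /multiplicity -sum1_count.
by rewrite (big_nth m) big_mkord; congr _%:R; apply: eq_bigl => j; rewrite eq_sym.
Qed.

Lemma wick_ge0 u s : 0 <= wick u s.
Proof. by apply: sumr_ge0. Qed.

Lemma wick_le u s : wick u s <= (size (pairings k u s))%:R.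
Proof.
rewrite /wick -sum1_size natr_sum; apply: ler_sum => p _.
by rewrite ler_nat leq_b1.
Qed.
End WickCount.

(** * Families with a triple coincidence are negligible *)

Section Coincidences.
Variables (R : realType) (L : finType) (n : nat) (rr : L -> nat).
Hypothesis rrn : forall a, (rr a <= n)%N.
Local Notation fam := {ffun L -> {set 'I_n}}.
Implicit Types (x : fam) (pi : {ffun L -> L}).

(** [pi] maps each letter to the representative of its class, in a partition of
    the letters into classes of at least two elements, one of which has at
    least three. *)
Definition blocks_ok pi : bool :=
  [&& [forall m, pi (pi m) == pi m], [forall m, rr (pi m) == rr m],
      [forall m, (pi m == m) ==> (2 <= #|[pred a | pi a == m]|)%N] &
      [exists m, (pi m == m) && (3 <= #|[pred a | pi a == m]|)%N]].

Let root_sqrt m : R := Num.sqrt ('C(n, rr m)%:R).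

(** The letters that are not representatives are matched to distinct random
    sets that do not occur elsewhere, so each match has mean 1 independently of
    the others. *)
Lemma family_mean_blocks pi (s : seq L) :
  (forall m, pi (pi m) = pi m) -> (forall m, rr (pi m) = rr m) ->
  uniq s -> {in s, forall m, pi m != m} ->
  family_mean rr (fun x => \prod_(m <- s) collision R rr m (pi m) x) = 1.
Proof.
move=> pipi rpi; elim: s => [|m s IH] us hs.
  by under eq_fun do rewrite big_nil; rewrite family_mean_const.
have [ms us'] : m \notin s /\ uniq s by move: us => /= /andP.
have hs' : {in s, forall m, pi m != m} by move=> a as_; apply: hs; rewrite inE as_ orbT.
rewrite -[RHS](IH us' hs').
under eq_fun do rewrite big_cons.
have pm : pi m != m by apply: hs; rewrite inE eqxx.
apply: (family_mean_collision rrn pm); first by rewrite rpi.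
move=> x S; apply: eq_big_seq => a as_; rewrite /collision !upd_other //.
  by apply: contraNneq pm => <-; rewrite pipi.
by apply: contraNneq ms => <-.
Qed.

(** A class of [b] letters with binomial C has b normalisations C^(1/2) and
    b - 1 matches of probability 1 / C, altogether C^(1 - b/2). This is at most
    1 for b >= 2 and at most C^(-1/2) for b >= 3. *)
Lemma blocks_weight pi (N : R) : blocks_ok pi -> 1 <= N ->
  (forall m, N <= 'C(n, rr m)%:R) ->
  (\prod_m root_sqrt m) * \prod_(m | pi m != m) ('C(n, rr m)%:R)^-1 <= (Num.sqrt N)^-1.
Proof.
move=> /and4P[/forallP pipi /forallP rpi /forallP f2 /existsP[m0 /andP[pm0 f3]]] N1 hN.
have C0 m : 0 < 'C(n, rr m)%:R :> R by apply: lt_le_trans (hN m); lra.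
have s0 m : 0 < root_sqrt m by rewrite sqrtr_gt0.
have sN : 1 <= Num.sqrt N by rewrite -[leLHS]sqrtr1 ler_sqrt; lra.
have sm m : Num.sqrt N <= root_sqrt m by rewrite ler_sqrt.
have s2 m : root_sqrt m * root_sqrt m = 'C(n, rr m)%:R by rewrite -expr2 sqr_sqrtr // ltW.
rewrite [X in _ * X]big_mkcond -big_split /=.
rewrite (partition_big (fun m => pi m) (fun m => pi m == m)) /=; last by move=> m _.
have fib m : pi m == m ->
    \prod_(a | pi a == m) (root_sqrt a * (if pi a != a then ('C(n, rr a)%:R)^-1 else 1))
    = (root_sqrt m)^-1 ^+ (#|[pred a | pi a == m]| - 2).
  move=> pm; have f2m := implyP (f2 m) pm.
  have ra a : pi a == m -> root_sqrt a = root_sqrt m.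
    by move=> /eqP <-; rewrite /root_sqrt (eqP (rpi a)).
  rewrite (bigD1 m) //= pm mulr1.
  have card2 : #|[pred a | pi a == m]| = #|[pred a | (pi a == m) && (a != m)]|.+1.
    rewrite (cardD1 m) inE pm add1n; congr _.+1; apply: eq_card => a.
    by rewrite !inE andbC.
  rewrite (eq_bigr (fun=> (root_sqrt m)^-1)); last first.
    move=> a /andP[pa am]; rewrite -(ra a pa) (_ : pi a != a); last first.
      by apply: contraNneq am => paa; rewrite -paa.
    by rewrite -s2 invfM mulrA divff ?mul1r // gt_eqF.
  rewrite prodr_const; move: f2m; rewrite card2.
  case: #|_| => [//|c] _; rewrite subSS subn1 exprS mulrA divff ?mul1r //.
  by rewrite gt_eqF.
rewrite (eq_bigr _ fib) (bigD1 m0) //=.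
have inv1 m : 0 <= (root_sqrt m)^-1 <= 1.
  by rewrite invr_ge0 ltW //= invf_le1 // (le_trans sN).
rewrite -[leRHS]mulr1; apply: ler_pM.
- by rewrite exprn_ge0 //; case/andP: (inv1 m0).
- by apply: prodr_ge0 => m _; rewrite exprn_ge0 //; case/andP: (inv1 m).
- apply: (@le_trans _ _ (root_sqrt m0)^-1).
    rewrite -[leRHS]expr1; by apply: ler_wiXn2l; rewrite ?subn_gt0 //; case/andP: (inv1 m0).
  by rewrite lef_pV2 ?posrE // (lt_le_trans _ sN).
apply: prodr_ile1 => m _; case/andP: (inv1 m) => i0 i1.
by rewrite exprn_ge0 //= exprn_ile1.
Qed.

Section Coincident.
Variables (K : eqType) (k : L -> K).
Hypothesis krr : forall m m', k m = k m' -> rr m = rr m'.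

Definition class_size x m := #|[pred a | (k a, x a) == (k m, x m)]|.

Definition coincident x : bool :=
  [forall m, (2 <= class_size x m)%N] && [exists m, (3 <= class_size x m)%N].

(** The classes of the relation of having the same label and the same set. *)
Lemma coincident_blocks x : coincident x ->
  exists2 pi, blocks_ok pi & [forall m, x (pi m) == x m].
Proof.
move=> /andP[/forallP m2 /existsP[m0 m3]].
pose y a := (k a, x a).
pose f m := odflt m [pick a | y a == y m].
have yf m : y (f m) = y m.
  by rewrite /f; case: pickP => [a /eqP//|/(_ m)]; rewrite eqxx.
have fy a m : y a = y m -> f a = f m.
  move=> yam; rewrite /f (eq_pick (Q := fun b => y b == y m)); last by move=> b; rewrite yam.
  by case: pickP => // /(_ m); rewrite eqxx.
exists [ffun m => f m].
  have ff m : f (f m) = f m by apply: fy; exact: yf.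
  have card m : #|[pred a | [ffun m => f m] a == f m]| = class_size x m.
    apply: eq_card => a; rewrite !inE ffunE; apply/eqP/eqP => [e|e].
      by rewrite -/(y a) -(yf a) e yf.
    exact: fy.
  apply/and4P; split.
  - by apply/forallP => m; rewrite !ffunE ff.
  - by apply/forallP => m; rewrite ffunE; apply/eqP/krr; case: (yf m).
  - by apply/forallP => m; rewrite ffunE; apply/implyP => /eqP fm; rewrite -{1}fm card.
  - apply/existsP; exists (f m0); rewrite ffunE ff eqxx /= card //.
by apply/forallP => m; rewrite ffunE; case: (yf m) => _ ->.
Qed.

(** Union bound over the finitely many class structures, each of which
    is estimated by [blocks_weight]. *)
Lemma coincident_negligible (N : R) : 1 <= N -> (forall m, N <= 'C(n, rr m)%:R) ->
  (\prod_m (root_sqrt m)^-1) * \sum_(x | sized rr x) (coincident x)%:R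
  <= #|{ffun L -> L}|%:R * (Num.sqrt N)^-1.
Proof.
move=> N1 hN.
have C0 m : 0 < 'C(n, rr m)%:R :> R by apply: lt_le_trans (hN m); lra.
have s0 m : 0 < root_sqrt m by rewrite sqrtr_gt0.
have s2 m : root_sqrt m * root_sqrt m = 'C(n, rr m)%:R by rewrite -expr2 sqr_sqrtr // ltW.
have -> : \sum_(x | sized rr x) (coincident x)%:R
   = \prod_m 'C(n, rr m)%:R * family_mean rr (fun x => (coincident x)%:R) :> R.
  rewrite /family_mean mulrA divff ?mul1r //.
  by rewrite prodf_seq_neq0; apply/allP => m _; rewrite gt_eqF.
rewrite mulrA -big_split /= (eq_bigr root_sqrt); last first.
  by move=> m _; rewrite -s2 mulrA mulVf ?mul1r // gt_eqF.
have P0 : 0 <= \prod_m root_sqrt m by apply: prodr_ge0 => m _; exact: ltW.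
apply: (@le_trans _ _ ((\prod_m root_sqrt m) * family_mean rr (fun x =>
    \sum_(pi | blocks_ok pi) (\prod_(m | pi m != m) ('C(n, rr m)%:R)^-1)
      * \prod_(m <- [seq m <- enum L | pi m != m]) collision R rr m (pi m) x))).
  rewrite ler_wpM2l //; apply: (family_mean_le rrn) => x _.
  have pos pi : 0 <= (\prod_(m | pi m != m) ('C(n, rr m)%:R)^-1 : R)
      * \prod_(m <- [seq m <- enum L | pi m != m]) collision R rr m (pi m) x.
    by rewrite mulr_ge0 //; apply: prodr_ge0 => m _; rewrite /collision ?invr_ge0 ?mulr_ge0 // ltW.
  have [/coincident_blocks[pi okpi /forallP xpi]|_] := boolP (coincident x); last exact: sumr_ge0.
  rewrite (bigD1 pi) //= ler_wpDr ?sumr_ge0 //.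
  rewrite big_filter big_enum_cond /= -big_split /= big1 // => m pm.
  by rewrite /collision eq_sym (xpi m) mulr1 mulVf // gt_eqF.
have -> : family_mean rr (fun x =>
    \sum_(pi | blocks_ok pi) (\prod_(m | pi m != m) ('C(n, rr m)%:R)^-1)
      * \prod_(m <- [seq m <- enum L | pi m != m]) collision R rr m (pi m) x)
   = \sum_(pi | blocks_ok pi) (\prod_(m | pi m != m) ('C(n, rr m)%:R)^-1).
  rewrite /family_mean exchange_big mulr_sumr /=; apply: eq_bigr => pi.
  move=> /and4P[/forallP pipi /forallP rpi _ _].
  rewrite -mulr_sumr mulrCA -[X in _ * X]/(family_mean rr _) family_mean_blocks ?mulr1 //.
  - by move=> m; apply/eqP.
  - by move=> m; apply/eqP.
  - by rewrite filter_uniq // enum_uniq.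
  - by move=> m; rewrite mem_filter => /andP[].
rewrite mulr_sumr; apply: (@le_trans _ _ (\sum_(pi | blocks_ok pi) (Num.sqrt N)^-1)).
  by apply: ler_sum => pi okpi; exact: blocks_weight.
rewrite sumr_const -[_ *+ _]mulr_natl ler_wpM2r ?invr_ge0 ?sqrtr_ge0 // ler_nat.
exact: max_card.
Qed.
End Coincident.
End Coincidences.

(** * Moments of the random coefficients *)

Section MomentBounds.
Local Open Scope ring_scope.
Context d (T : measurableType d) (R : realType) (P : probability T R).

(** Even moments dominate the others, since |X|^c <= 1 + X^(2c). *)
Lemma integrable_powers (X : T -> R) : measurable_fun setT X ->
  (forall p, (1 <= p)%N -> ('E_P[fun w => (X w ^+ (2 * p))%R] < +oo)%E) ->
  forall c, P.-integrable setT (fun w => (X w ^+ c)%:E).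
Proof.
move=> mX h c.
have mpow p : measurable_fun setT (fun w => (X w ^+ p)%:E).
  by apply/measurable_EFinP; exact: measurable_funX.
have even p : (1 <= p)%N -> P.-integrable setT (fun w => (X w ^+ (2 * p))%:E).
  move=> p1; apply/integrableP; split=> //.
  under eq_integral.
    move=> w _; rewrite abse_EFin ger0_norm; last first.
      by rewrite exprM exprn_ge0 // sqr_ge0.
    over.
  by have := h p p1; rewrite unlock.
have one : P.-integrable setT (fun _ : T => (1 : R)%:E).
  exact: finite_measure_integrable_cst.
case: c => [|c]; first by under eq_fun do rewrite expr0.
apply: (le_integrable _ (mpow _) _ (integrableD measurableT one (even c.+1 isT))) => //.
move=> w _; rewrite -EFinD !abse_EFin lee_fin mul2n -addnn exprD.
rewrite normrX [X in _ <= X]ger0_norm; last by rewrite addr_ge0 // -expr2 sqr_ge0.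
rewrite -expr2 -[X w ^+ _ ^+ 2]real_normK ?num_real // normrX.
move: (_ ^+ _) (exprn_ge0 c.+1 (normr_ge0 (X w))) => v v0; nra.
Qed.

Section MomentsOfProducts.
Variables (I : choiceType) (L : finType) (n : nat).
Local Notation K := (I * {set 'I_n})%type.
Variables (D : set K) (X : K -> T -> R) (M : R) (k : L -> I).
Hypothesis mX : forall z, measurable_fun setT (X z).
Hypothesis indX : mutually_independent P D X.
Let mom z c := fine ('E_P[fun w => (X z w ^+ c)%R])%E.
Hypothesis hint : forall z, D z -> forall c, P.-integrable setT (fun w => (X z w ^+ c)%:E).
Hypothesis M1 : 1 <= M.
Hypothesis hM : forall z, D z -> forall c, (0 < c <= #|L|)%N -> `|mom z c| <= M.
Hypothesis mom1 : forall z, D z -> mom z 1 = 0.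
Hypothesis mom2 : forall z, D z -> mom z 2 = 1.

Variable x : {ffun L -> {set 'I_n}}.
Hypothesis xD : forall m, D (k m, x m).

Let ys := [seq (k m, x m) | m <- enum L].

Lemma expectation_monomial :
  P.-integrable setT (fun w => (\prod_m X (k m, x m) w)%:E) /\
  ('E_P[fun w => (\prod_m X (k m, x m) w)%R] =
    (\prod_(z <- undup ys) mom z (count_mem z ys))%R%:E)%E.
Proof.
have E w : \prod_m X (k m, x m) w = \prod_(z <- undup ys) X z w ^+ count_mem z ys.
  by rewrite [RHS]prodr_undup_exp_count big_map big_enum.
have FE : (fun w => \prod_m X (k m, x m) w)
    = (fun w => \prod_(z <- undup ys) X z w ^+ count_mem z ys) by exact: funext.
rewrite FE (_ : (fun w => (\prod_m X (k m, x m) w)%:E)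
    = (fun w => (\prod_(z <- undup ys) X z w ^+ count_mem z ys)%:E)); last first.
  by apply/funext => w; rewrite E.
have [] := @expectation_prod_independent _ _ _ P _ D X mX indX (undup ys)
  (fun z t => t ^+ count_mem z ys).
- exact: undup_uniq.
- by move=> z /=; rewrite mem_undup => /mapP[m _ ->].
- by move=> z; exact: measurable_funX.
- by move=> z; rewrite mem_undup => /mapP[m _ ->]; exact: hint.
by move=> i1 ->; split=> //; congr (_%:E).
Qed.

(** Both terms agree when a coefficient occurs only once (they vanish) or when
    all of them occur twice (they are 1). In the remaining case the letters are
    [coincident], and each term is bounded separately. *)
Lemma expectation_monomial_wick s : perm_eq s (enum L) ->
  `|fine ('E_P[fun w => (\prod_m X (k m, x m) w)%R])%E - wick R k x [::] s|
    <= (M ^+ #|L| + (size (pairings k [::] s))%:R) * (coincident k x)%:R.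
Proof.
move=> ps; rewrite (proj2 expectation_monomial) /=.
have ms z : multiplicity k x s z = count_mem z ys.
  rewrite /multiplicity (permP ps) [RHS]count_map.
  by apply: eq_count => m.
have mc m : class_size k x m = count_mem (k m, x m) ys.
  by rewrite /class_size -ms /multiplicity (permP ps) cardE size_filter -enumT.
pose bad m := count_mem (k m, x m) ys == 1%N.
have [/existsP[m /eqP m1]|nob] := boolP [exists m, bad m].
  have my : (k m, x m) \in ys by rewrite map_f ?mem_enum.
  have -> : wick R k x [::] s = 0.
    by apply: (@wick_eq0 _ _ _ _ _ _ _ _ (k m, x m)); rewrite ms m1.
  rewrite (bigD1_seq (k m, x m)) ?mem_undup ?undup_uniq //= m1 mom1 // mul0r subrr normr0.
  by rewrite mulr_ge0 // addr_ge0 // exprn_ge0 // (le_trans ler01).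
have c2 m : (2 <= count_mem (k m, x m) ys)%N.
  have my : (k m, x m) \in ys by rewrite map_f ?mem_enum.
  move: nob; rewrite negb_exists => /forallP/(_ m); rewrite /bad.
  by move: my; rewrite -has_pred1 has_count; lia.
have [/existsP[m m3]|no3] := boolP [exists m, 3 <= count_mem (k m, x m) ys]%N.
  have -> : coincident k x.
    apply/andP; split; first by apply/forallP => a; rewrite mc.
    by apply/existsP; exists m; rewrite mc.
  rewrite mulr1; apply: (le_trans (ler_normB _ _)); apply: lerD; last first.
    by rewrite ger0_norm ?wick_ge0 // wick_le.
  rewrite normr_prod.
  apply: (@le_trans _ _ (\prod_(z <- undup ys) M)).
    rewrite [leLHS]big_seq [leRHS]big_seq; apply: ler_prod => z.
    rewrite mem_undup => /mapP[a _ ->]; rewrite normr_ge0 hM //.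
    rewrite (leq_trans _ (c2 a)) //= (leq_trans (count_size _ _)) //.
    by rewrite size_map -cardE.
  rewrite big_const_seq count_predT iter_mulr_1 ler_weXn2l // .
  by rewrite (leq_trans (size_undup _)) // size_map -cardE.
have e2 m : count_mem (k m, x m) ys = 2.
  move: no3; rewrite negb_exists => /forallP/(_ m); rewrite -ltnNge ltnS => c3.
  by apply/eqP; rewrite eqn_leq c3 c2.
have -> : wick R k x [::] s = 1.
  apply: wick_eq1 => z; rewrite ms.
  have [/mapP[m _ ->]|zy] := boolP (z \in ys); first by rewrite e2.
  by rewrite (count_memPn zy).
rewrite big_seq big1; last first.
  by move=> z; rewrite mem_undup => /mapP[m _ ->]; rewrite e2 mom2.
rewrite subrr normr0 mulr_ge0 // addr_ge0 // exprn_ge0 // (le_trans ler01) //.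
Qed.
End MomentsOfProducts.
End MomentBounds.

Local Open Scope classical_set_scope.

Section ComplexExpectation.
Context d (T : measurableType d) (R : realType) (P : probability T R).

Lemma complex_expectation_sum (X : finType) (Q : pred X) (f : X -> T -> R) (c : X -> R[i]) :
  (forall x, Q x -> P.-integrable setT (fun w => (f x w)%:E)) ->
  let F w := \sum_(x | Q x) (f x w)%:C * c x in
  complex_integrable P F /\
  complex_expectation P F = \sum_(x | Q x) (fine ('E_P[f x])%E)%:C * c x.
Proof.
move=> fi F.
have ReE w : complex.Re (F w) = \sum_(x | Q x) f x w * complex.Re (c x).
  rewrite /F raddf_sum /=; apply: eq_bigr => x _.
  by case: (c x) => a b /=; rewrite mul0r subr0.
have ImE w : complex.Im (F w) = \sum_(x | Q x) f x w * complex.Im (c x).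
  rewrite /F raddf_sum /=; apply: eq_bigr => x _.
  by case: (c x) => a b /=; rewrite mul0r addr0.
have lin (g : X -> R) :
    P.-integrable setT (fun w => (\sum_(x | Q x) f x w * g x)%:E) /\
    fine ('E_P[fun w => (\sum_(x | Q x) f x w * g x)%R])%E
      = \sum_(x | Q x) fine ('E_P[f x])%E * g x.
  have FE : (fun w => (\sum_(x | Q x) f x w * g x)%:E)
      = (fun w => \sum_(x | Q x) (g x)%:E * (f x w)%:E)%E.
    by apply/funext => w; rewrite -sumEFin; apply: eq_bigr => x _; rewrite -EFinM mulrC.
  have Fi x : Q x -> P.-integrable setT (fun w => ((g x)%:E * (f x w)%:E)%E).
    by move=> Qx; apply: integrableZl => //; exact: fi.
  split; first by rewrite FE; exact: integrable_sum.
  pose F' x : T -> \bar R := if Q x then (fun w => (g x)%:E * (f x w)%:E)%E else cst 0%E.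
  have F'i x : P.-integrable setT (F' x).
    rewrite /F'; case: ifPn => [|_]; [exact: Fi|exact: integrable0].
  transitivity (fine (\sum_(x | Q x) \int[P]_w F' x w)%E).
    rewrite unlock -integral_sum //; congr fine; apply: eq_integral => w _.
    rewrite -sumEFin; apply: eq_bigr => x Qx.
    by rewrite /F' Qx -EFinM mulrC.
  rewrite (eq_bigr (fun x => (fine ('E_P[f x])%E * g x)%:E)) ?sumEFin // => x Qx.
  rewrite /F' Qx integralZl //; last exact: fi.
  by rewrite EFinM fineK ?unlock ?integrable_fin_num 1?muleC //; exact: fi.
split.
  split; [under eq_fun do rewrite ReE|under eq_fun do rewrite ImE]; exact: (lin _).1.
rewrite /complex_expectation.
rewrite (_ : (fun w => complex.Re (F w))
  = (fun w => \sum_(x | Q x) f x w * complex.Re (c x))); last exact: funext.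
rewrite (_ : (fun w => complex.Im (F w))
  = (fun w => \sum_(x | Q x) f x w * complex.Im (c x))); last exact: funext.
rewrite (lin _).2 (lin _).2; apply/eqP; rewrite eq_complex /= !raddf_sum /=.
by apply/andP; split; apply/eqP/eq_bigr => x _; case: (c x) => a b /=; rewrite mul0r ?subr0 ?addr0.
Qed.
End ComplexExpectation.

(** * Limits of the mean signs *)

Section Limits.
Variable R : realType.

Lemma norm_real_complex (a : R) : `|a%:C| = `|a|%:C :> R[i].
Proof. by rewrite normc_def /= expr0n addr0 sqrtr_sqr. Qed.

Lemma cvg_real_complex (f : nat -> R[i]) (g h : nat -> R) (l : R) :
  g @ \oo --> l -> h @ \oo --> (0 : R) ->
  (\forall n \near \oo, `|f n - (g n)%:C| <= (h n)%:C) ->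
  (f n : R[i]^o) @[n --> \oo] --> (l%:C : R[i]^o).
Proof.
move=> gl h0 fgh; apply/cvgrPdist_le => e e0.
have [a ea a0] : exists2 a : R, e = a%:C & 0 < a.
  by case: e e0 => a b; rewrite ltcE /= => /andP[/eqP -> a0]; exists a.
have e2 : 0 < a / 2 by rewrite divr_gt0.
near=> n.
have gn : `|l - g n| <= a / 2.
  by near: n; move/cvgrPdist_le : gl; apply.
have hn : `|0 - h n| <= a / 2.
  by near: n; move/cvgrPdist_le : h0; apply.
have fn : `|f n - (g n)%:C| <= (h n)%:C by near: n.
rewrite sub0r normrN in hn.
apply: (@le_trans _ _ (`|l%:C - (g n)%:C| + `|(g n)%:C - f n|)).
  by have := ler_distD ((g n)%:C) l%:C (f n).
rewrite [X in _ + X]distrC -rmorphB norm_real_complex.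
apply: (le_trans (lerD (lexx _) fn)).
rewrite -rmorphD ea lecR.
have := ler_norm (h n); lra.
Unshelve. all: by end_near. Qed.

(** An infinite limit gives 0 on both sides, in accordance with the convention
    exp(- oo) = 0. *)
Lemma cvg_expRN_ereal (y : nat -> R) (lam : \bar R) :
  (0 <= lam)%E -> ((y n)%:E @[n --> \oo] --> lam)%E ->
  expR (- (2 * y n)) @[n --> \oo] --> fine (expeR (- (2%:E * lam))%E).
Proof.
case: lam => [r _|_|//] yl.
  have yr : y n @[n --> \oo] --> r by move/fine_cvg : yl.
  rewrite /= ; apply: continuous_cvg; first exact: continuous_expR.
  by apply: cvgN; apply: cvgMr.
have yp : y n @[n --> \oo] --> +oo by move/cvgeryP : yl.
have -> : fine (expeR (- (2%:E * +oo))%E) = 0 :> R.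
  by rewrite gt0_muley // lte_fin.
have : expR (- z) @[z --> +oo] --> (0 : R) by exact: cvgr_expR.
move=> h; apply: (cvg_comp (fun n => 2 * y n) (fun z => expR (- z)) _ h).
apply/cvgryPge => z; move/cvgryPge/(_ (z / 2)) : yp.
by apply: filterS => n; rewrite ler_pdivrMr // mulrC.
Qed.
End Limits.

Section PairingLimits.
Variables (R : realType) (I : choiceType) (n0 : nat) (r : I -> nat -> nat).
Hypothesis hn0 : (1 <= n0)%N.
Hypothesis hr : forall k n, (n0 <= n)%N -> (1 <= r k n <= n)%N.
Hypothesis hsmall : forall i : I, (r i n)%:R / n%:R @[n --> \oo] --> (0 : R).
Variables (lambda : I -> I -> \bar R) (q : I -> I -> R).
Hypothesis hlambda0 : forall i j, (0 <= lambda i j)%E.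
Hypothesis hlambda : forall i j,
  (((r i n)%:R * (r j n)%:R / n%:R : R)%:E @[n --> \oo] --> lambda i j).
Hypothesis hq : forall i j n, (n0 <= n)%N ->
  q i j = (-1) ^+ (r i n * r j n) * fine (expeR (- (2%:E * lambda i j))%E).
Variables (L : finType) (k : L -> I).
Let rr n m := r (k m) n.

Lemma cvg_pair_limit a b :
  pair_limit R n (rr n) a b @[n --> \oo] --> q (k a) (k b).
Proof.
have ecv := cvg_expRN_ereal (hlambda0 (k a) (k b)) (@hlambda (k a) (k b)).
apply/cvgrPdist_le => e e0; move/cvgrPdist_le/(_ e e0): ecv => ecv.
near=> n.
have nn0 : (n0 <= n)%N by near: n; exact: nbhs_infty_ge.
rewrite (hq _ _ nn0) /pair_limit -mulrBr normrM normr_sign mul1r.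
by near: n.
Unshelve. all: by end_near. Qed.

Lemma cvg_total_size v (N : seq L) :
  (rr n v + total_size (rr n) N)%:R / n%:R @[n --> \oo] --> (0 : R).
Proof.
elim: N => [|a N IH].
  by under eq_fun do rewrite /total_size big_nil addn0; exact: hsmall.
have -> : (fun n => (rr n v + total_size (rr n) (a :: N))%:R / n%:R : R)
   = (fun n => (rr n v + total_size (rr n) N)%:R / n%:R + (rr n a)%:R / n%:R).
  apply/funext => n; rewrite -mulrDl -natrD; congr (_%:R / _).
  by rewrite /total_size big_cons [X in (_ + X)%N]addnC addnA.
by rewrite -[0]addr0; apply: cvgD => //; exact: hsmall.
Qed.

Definition star_mean n (p : seq (L * L * seq L)) : R :=
  family_mean (rr n) (fun x : {ffun L -> {set 'I_n}} =>
    star_weight (pair_sign R (rr n) x) p).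

(** The stars are averaged out in the order of the list, each up to an error
    which tends to 0 by [family_mean_star]. *)
Lemma cvg_star_mean p : well_formed p ->
  star_mean n p @[n --> \oo] --> star_weight (fun a b => q (k a) (k b)) p.
Proof.
elim: p => [|t p IH] wp.
  apply/cvgrPdist_le => e e0; near=> n.
  have nn0 : (n0 <= n)%N by near: n; exact: nbhs_infty_ge.
  have rn a : (rr n a <= n)%N by case/andP: (hr (k a) nn0).
  rewrite /star_mean (eq_family_mean (g := fun=> 1)); last first.
    by move=> x _; rewrite /star_weight big_nil.
  by rewrite family_mean_const // /star_weight big_nil subrr normr0 ltW.
have wp' : well_formed p by move: wp => /= /and5P[_ _ _ _ /andP[]].
rewrite star_weight_cons.
pose lim_n n := (\prod_(a <- t.2) pair_limit R n (rr n) t.1.2 a)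
    * star_mean n p.
have lim_cvg : lim_n n @[n --> \oo] -->
    (\prod_(a <- t.2) q (k t.1.2) (k a)) * star_weight (fun a b => q (k a) (k b)) p.
  apply: cvgM; last exact: IH.
  elim: (t.2) => [|a N IHN].
    by under eq_fun do rewrite big_nil; rewrite big_nil; exact: cvg_cst.
  under eq_fun do rewrite big_cons; rewrite big_cons.
  by apply: cvgM => //; exact: cvg_pair_limit.
pose eps n : R := (rr n t.1.2 + total_size (rr n) t.2)%:R / n%:R.
have small : eps n @[n --> \oo] --> (0 : R) by exact: cvg_total_size.
apply/cvgrPdist_le => e e0.
have e2 : 0 < e / 2 by lra.
have e44 : 0 < e / 44 by lra.
near=> n.
have nn0 : (n0 <= n)%N by near: n; exact: nbhs_infty_ge.
have rn a : (rr n a <= n)%N by case/andP: (hr (k a) nn0).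
have n_gt0 : (0 < n)%N by exact: leq_trans nn0.
have s1 : `|0 - eps n| <= e / 44.
  by near: n; move/cvgrPdist_le : small; apply.
have s2 : `|0 - eps n| <= 16^-1.
  by near: n; move/cvgrPdist_le : small; apply; rewrite invr_gt0.
rewrite sub0r normrN in s1 s2.
have s3 : `|(\prod_(a <- t.2) q (k t.1.2) (k a))
            * star_weight (fun a b => q (k a) (k b)) p - lim_n n| <= e / 2.
  by near: n; move/cvgrPdist_le : lim_cvg; apply.
have := @family_mean_star R L n (rr n) rn t p n_gt0 (le_trans (ler_norm _) s2) wp.
rewrite -/(eps n) -!/(star_mean n _) -/(lim_n n) distrC => s4.
apply: (le_trans (ler_distD (lim_n n) _ _)).
have := ler_norm (eps n); lra.
Unshelve. all: by end_near. Qed.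
End PairingLimits.

(** * Exact formulas at finite size *)

Section FiniteSize.
Variables (R : realType).

Lemma pairings_prod (I L : eqType) (k : L -> I) (f : L -> R) u s p :
  p \in pairings k u s ->
  \prod_(t <- p) (f t.1.1 * f t.1.2) = \prod_(m <- u ++ s) f m.
Proof.
elim: s u p => [|m s IH] u p /=.
  by case: u => //; rewrite inE => /eqP->; rewrite !big_nil.
rewrite mem_cat => /orP[/IH->|/flattenP[ps /mapP[j]]].
  by rewrite cat_cons big_cons !big_cat big_cons mulrCA.
rewrite mem_filter mem_iota add0n => /andP[_ /= ju] -> /mapP[p' /IH E ->].
rewrite big_cons E /= [in RHS](remove_atE m ju) /remove_at !big_cat !big_cons /=.
by ring.
Qed.

(** The case r = n is excluded because the binomial is then 1. Small densities
    keep away from it, and then coincidences are rare. *)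
Lemma leq_bin n r : (1 <= r < n)%N -> (n <= 'C(n, r))%N.
Proof.
elim: n r => [|n IH] [|r] //=; rewrite ltnS => rn.
case: r rn => [|r] rn; first by rewrite bin1.
have h : (n <= 'C(n, r.+1))%N by apply: IH.
by rewrite binS -addn1 addnC leq_add // bin_gt0.
Qed.

Section FixedSize.
Variables (I : choiceType) (L : finType) (n : nat) (k : L -> I) (rr : L -> nat).
Hypothesis rrn : forall a, (rr a <= n)%N.
Hypothesis krr : forall a b, k a = k b -> rr a = rr b.
Local Notation fam := {ffun L -> {set 'I_n}}.

Definition normalization : R := \prod_m (Num.sqrt ('C(n, rr m)%:R))^-1.

(** Each block uses two normalisations of the same value, so that their product
    is one binomial coefficient for each block, the weight of [collision]. *)
Lemma sum_compatible s p : perm_eq s (enum L) -> p \in pairings k [::] s ->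
  normalization * \sum_(x : fam | sized rr x)
      (compatible x p)%:R * star_weight (pair_sign R rr x) p
  = family_mean rr (fun x : fam => star_weight (pair_sign R rr x) p).
Proof.
move=> ps pP.
have us : uniq s by rewrite (perm_uniq ps) enum_uniq.
have wp : well_formed p by apply: (pairings_wf _ pP).
have kp := pairings_matched pP.
have rp : {in p, forall t, rr t.1.1 = rr t.1.2} by move=> t /kp /krr.
transitivity (family_mean rr (fun x : fam => star_weight (pair_sign R rr x) p * 1)); last first.
  by under eq_family_mean do rewrite mulr1.
rewrite -(family_mean_collisions rrn wp rp); last by [].
have C0 m : 0 < 'C(n, rr m)%:R :> R by rewrite ltr0n bin_gt0.
have collE (x : fam) : \prod_(t <- p) collision R rr t.1.1 t.1.2 x
    = (\prod_(t <- p) 'C(n, rr t.1.1)%:R) * (compatible x p)%:R.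
  rewrite /collision big_split /=; congr (_ * _).
  elim: (p) => [|t p' IH]; first by rewrite big_nil.
  by rewrite big_cons IH /= -natrM mulnb.
have binE : \prod_(t <- p) 'C(n, rr t.1.1)%:R = \prod_m Num.sqrt ('C(n, rr m)%:R) :> R.
  rewrite -[RHS]big_enum -(perm_big _ ps) -[s]cat0s.
  rewrite -(pairings_prod (fun m => Num.sqrt ('C(n, rr m)%:R)) pP).
  apply: eq_big_seq => t /rp <-.
  by rewrite -expr2 sqr_sqrtr // ltW.
rewrite /family_mean /normalization mulr_sumr [RHS]mulr_sumr; apply: eq_bigr => x _.
rewrite collE binE mulr1 -!mulrA [RHS]mulrA; congr (_ * _).
rewrite prodfV.
have -> : \prod_a 'C(n, rr a)%:R = (\prod_m Num.sqrt ('C(n, rr m)%:R)) ^+ 2 :> R.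
  by rewrite -prodrXl; apply: eq_bigr => m _; rewrite sqr_sqrtr // ltW.
have S0 : \prod_m Num.sqrt ('C(n, rr m)%:R) != 0 :> R.
  by rewrite prodf_seq_neq0; apply/allP => m _; rewrite gt_eqF // sqrtr_gt0.
by field.
Qed.

Lemma star_weight_set_sign (x : fam) p : sized rr x ->
  star_weight (fun a b => set_sign R[i] (x a) (x b)) p
  = (star_weight (pair_sign R rr x) p)%:C.
Proof.
move=> /sizedP sx; rewrite /star_weight rmorph_prod; apply: eq_bigr => t _.
rewrite rmorph_prod; apply: eq_bigr => a _.
by rewrite /set_sign /pair_sign !sx rmorphXn rmorphN1.
Qed.

End FixedSize.

Section Syk.
Variables (A : algType R[i]) (psi : nat -> A) (tr : A -> R[i]).
Hypothesis car : forall j k,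
  psi j * psi k + psi k * psi j = ((j == k)%:R *+ 2)%:A.
Hypothesis htr : is_normalized_trace psi tr.
Variables (I : choiceType) (d n : nat) (k : 'I_d -> I) (rr : 'I_d -> nat).
Hypothesis rrn : forall a, (rr a <= n)%N.
Hypothesis krr : forall a b, k a = k b -> rr a = rr b.
Local Notation fam := {ffun 'I_d -> {set 'I_n}}.

Let tPsi (x : fam) : R[i] := tr (\prod_(m < d) Psi psi (x m)).

Lemma sykE r (J : {set 'I_n} -> R) : syk psi r J =
  \sum_(S : {set 'I_n} | #|S| == r) ((Num.sqrt ('C(n, r)%:R))^-1 * J S)%:C *: Psi psi S.
Proof.
rewrite /syk scaler_sumr; apply: eq_bigr => S /eqP <-.
rewrite /Psi !scalerA rmorphM fmorphV; congr (_ *: _); ring.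
Qed.

Lemma trace_prod_syk (J : 'I_d -> {set 'I_n} -> R) :
  tr (\prod_(m < d) syk psi (rr m) (J m)) =
  \sum_(x : fam | sized rr x)
    (\prod_m J m (x m))%:C * ((normalization n rr)%:C * tPsi x).
Proof.
under eq_bigr do rewrite sykE.
rewrite bigA_distr_big_dep /= -big_filter (trace_sum htr) //; last first.
  move=> x; apply: gen_alg_prod => m; apply: gen_algZ; exact: gen_alg_Psi.
rewrite big_filter; apply: eq_big => x.
  by apply/familyP/sizedP => h m; apply/eqP; apply: h.
move=> _; rewrite scaler_prod (traceZ htr) //; last first.
  by apply: gen_alg_prod => m; exact: gen_alg_Psi.
rewrite mulrA -rmorph_prod -rmorphM; congr (_%:C * _).
by rewrite big_split /= mulrC.
Qed.

(** Only compatible pairings contribute to [wick], and for each of them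
    [Psi_pairing] computes the same trace. *)
Lemma wick_trace s (x : fam) : rev s = enum 'I_d -> sized rr x ->
  (wick R k x [::] s)%:C * tPsi x =
  (\sum_(p <- pairings k [::] s) (compatible x p)%:R * star_weight (pair_sign R rr x) p)%:C.
Proof.
move=> rs sx; rewrite /wick !rmorph_sum mulr_suml /=.
apply: eq_big_seq => p pP; rewrite [RHS]rmorphM.
case: (boolP (compatible x p)) => [/allP xp|_]; last by rewrite rmorph0 !mul0r.
congr (_ * _); apply: etrans (star_weight_set_sign p sx); rewrite /tPsi.
have -> : \prod_(m < d) Psi psi (x m) = \prod_(m <- rev s) Psi psi (x m).
  by rewrite rs enumT [index_enum _]unlock.
have := Psi_pairing car pP (x := x); rewrite big_nil mulr1 => ->.
  by rewrite (traceZ htr) ?(trace1 htr) ?mulr1 //; exact: gen_alg1.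
by move=> t /xp /eqP.
Qed.

Lemma sum_wick_trace s : perm_eq s (enum 'I_d) -> rev s = enum 'I_d ->
  \sum_(x : fam | sized rr x)
     (wick R k x [::] s)%:C * ((normalization n rr)%:C * tPsi x)
  = (\sum_(p <- pairings k [::] s)
       family_mean rr (fun x : fam => star_weight (pair_sign R rr x) p))%:C.
Proof.
move=> ps rs.
transitivity (\sum_(x : fam | sized rr x) (normalization n rr *
   \sum_(p <- pairings k [::] s) (compatible x p)%:R * star_weight (pair_sign R rr x) p)%:C).
  apply: eq_bigr => x sx; rewrite mulrCA wick_trace //.
  by rewrite [RHS]rmorphM.
rewrite -rmorph_sum; congr (_%:C); rewrite -mulr_sumr exchange_big mulr_sumr /=.
by apply: eq_big_seq => p pP; exact: (sum_compatible rrn krr ps pP).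
Qed.

Lemma norm_tPsi_le1 (x : fam) : `|tPsi x| <= 1.
Proof. exact: norm_trace_Psi_le1. Qed.
End Syk.
End FiniteSize.

Section UniformMoments.
Context d (T : measurableType d) (R : realType) (P : probability T R).
Local Open Scope ereal_scope.

(** The bounds for the separate orders are merged into one for all orders up to
    [N], because a coefficient may occur as many times as there are letters. *)
Lemma uniform_moment_bound (Z : Type) (Q : Z -> Prop) (X : Z -> T -> R) :
  (forall z, Q z -> 'E_P[X z] = 0) ->
  (forall z, Q z -> 'E_P[fun w => (X z w ^+ 2)%R] = 1) ->
  (forall p : nat, (3 <= p)%N -> exists C : R,
     forall z, Q z -> `| 'E_P[fun w => (X z w ^+ p)%R] | <= C%:E) ->
  forall N : nat, exists2 M : R, (1 <= M)%R &
    forall z, Q z -> forall c, (0 < c <= N)%N ->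
      (`| fine 'E_P[fun w => (X z w ^+ c)%R] | <= M)%R.
Proof.
move=> h1 h2 hp; elim=> [|N [M M1 hM]].
  by exists 1%R => // z _ [|c].
have [C hC] : exists C : R, forall z, Q z -> (`|fine 'E_P[fun w => (X z w ^+ N.+1)%R]| <= C)%R.
  case: N {M M1 hM} => [|[|N]].
  - exists 0%R => z Qz; under eq_fun do rewrite expr1.
    by rewrite h1 // normr0.
  - by exists 1%R => z Qz; rewrite h2 //= normr1.
  - have [//|C hC] := hp N.+3; exists C => z /hC.
    by case: ('E_P[_]) => [a| |] //=.
exists (Num.max M C); first by rewrite le_max M1.
move=> z Qz c /andP[c0]; rewrite leq_eqVlt => /orP[/eqP->|cN].
  by rewrite le_max hC ?orbT.
by rewrite le_max hM // c0.
Qed.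
End UniformMoments.

Section SequenceLimits.
Variable R : realType.

Lemma cvg_sum_seq (S : eqType) (l : seq S) (f : S -> nat -> R) (g : S -> R) :
  {in l, forall p, f p n @[n --> \oo] --> g p} ->
  \sum_(p <- l) f p n @[n --> \oo] --> \sum_(p <- l) g p.
Proof.
elim: l => [|p l IH] h.
  by under eq_fun do rewrite big_nil; rewrite big_nil; exact: cvg_cst.
under eq_fun do rewrite big_cons; rewrite big_cons; apply: cvgD.
  by apply: h; rewrite inE eqxx.
by apply: IH => a al; apply: h; rewrite inE al orbT.
Qed.

Lemma cvg_inv_sqrtn : (Num.sqrt (n%:R : R))^-1 @[n --> \oo] --> (0 : R).
Proof.
apply/gtr0_cvgV0.
  by near=> n; rewrite sqrtr_gt0 ltr0n; near: n; exact: nbhs_infty_gt.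
apply/cvgryPge => a; near=> n.
apply: (le_trans (ler_norm a)); rewrite -sqrtr_sqr ler_wsqrtr //.
by near: n; exact: nbhs_infty_ger.
Unshelve. all: by end_near. Qed.
End SequenceLimits.

(** * The limit of the mixed moments *)

Theorem theorem1p1
  (R : realType) (dT : measure_display) (T : measurableType dT)
  (P : probability T R)
  (A : algType R[i]) (star : A -> A) (psi : nat -> A) (tr : A -> R[i])
  (hstar : is_star star) (hpsi : is_majorana star psi)
  (htr : is_normalized_trace psi tr)
  (I : choiceType) (n0 : nat) (hn0 : (1 <= n0)%N)
  (r : I -> nat -> nat)
  (hr : forall k n, (n0 <= n)%N -> (1 <= r k n <= n)%N)
  (J : forall (k : I) (n : nat), {set 'I_n} -> {RV P >-> R})
  (hJind : forall n, (n0 <= n)%N ->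
     mutually_independent P [set x : I * {set 'I_n} | #|x.2| = r x.1 n]
       (fun x => J x.1 n x.2))
  (hJ1 : forall k n (S : {set 'I_n}), (n0 <= n)%N -> #|S| = r k n ->
     ('E_P[J k n S] = 0)%E)
  (hJ2 : forall k n (S : {set 'I_n}), (n0 <= n)%N -> #|S| = r k n ->
     ('E_P[fun w => (J k n S w ^+ 2)%R] = 1)%E)
  (hJp : forall p : nat, (3 <= p)%N -> exists Cp : R,
     forall k n (S : {set 'I_n}), (n0 <= n)%N -> #|S| = r k n ->
       (`| 'E_P[fun w => (J k n S w ^+ p)%R] | <= Cp%:E)%E)
  (hparity : forall k m n, (n0 <= m)%N -> (n0 <= n)%N ->
     odd (r k m) = odd (r k n))
  (hsmall : forall i : I, (r i n)%:R / n%:R @[n --> \oo] --> (0 : R))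
  (lambda : I -> I -> \bar R)
  (hlambda0 : forall i j, (0 <= lambda i j)%E)
  (hlambda : forall i j,
     (((r i n)%:R * (r j n)%:R / n%:R : R)%:E @[n --> \oo] --> lambda i j))
  (q : I -> I -> R)
  (hq : forall i j n, (n0 <= n)%N ->
     q i j = (-1) ^+ (r i n * r j n)
             * fine (expeR (- (2%:E * lambda i j))%E))
  (d : nat) (hd : (1 <= d)%N) (k : 'I_d -> I) :
  let X (n : nat) (w : T) : R[i] :=
    tr (\prod_(m < d) syk psi (r (k m) n) (fun S => J (k m) n S w)) in
  (forall n, (n0 <= n)%N -> complex_integrable P (X n)) /\
  ((complex_expectation P (X n) : R[i]^o) @[n --> \oo] -->
     (vacuum_state q (\big[comp/id]_(m < d) qgauss q (k m)) : R[i]^o)).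
Proof.
move=> X.
have car := majorana_car hpsi.
pose rr n (m : 'I_d) := r (k m) n.
have rrn n : (n0 <= n)%N -> forall m, (rr n m <= n)%N.
  by move=> nn0 m; case/andP: (hr (k m) n nn0).
have krr n a b : k a = k b -> rr n a = rr n b by rewrite /rr => ->.
pose D n := [set x : I * {set 'I_n} | #|x.2| = r x.1 n].
(* The moment bounds must be uniform in n too, so the variables for all n are
   collected in a single family. *)
pose Z := {n : nat & (I * {set 'I_n})%type}.
pose Q (z : Z) := (n0 <= projT1 z)%N /\ D _ (projT2 z).
pose JZ (z : Z) : T -> R := J (projT2 z).1 (projT1 z) (projT2 z).2.
have [M M1 hM] : exists2 M : R, 1 <= M & forall z, Q z -> forall c, (0 < c <= d)%N ->
    `|fine ('E_P[fun w => (JZ z w ^+ c)%R])%E| <= M.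
  apply: uniform_moment_bound.
  - by case=> n [a S] [/= nn0 DS]; exact: hJ1.
  - by case=> n [a S] [/= nn0 DS]; exact: hJ2.
  - by move=> p /hJp[C hC]; exists C; case=> n [a S] [/= nn0 DS]; exact: hC.
pose JD n (z : I * {set 'I_n}) : T -> R := J z.1 n z.2.
have mJ n z : measurable_fun setT (@JD n z) by exact: measurable_funPT.
have pow n z : (n0 <= n)%N -> D n z -> forall c,
    P.-integrable setT (fun w => (JD n z w ^+ c)%:E).
  move=> nn0 Dz; apply: integrable_powers => // p p1.
  have [->|p2] := eqVneq p 1%N; first by rewrite hJ2 // ltry.
  have [C hC] := hJp (2 * p)%N ltac:(lia).
  apply: le_lt_trans (ltry C); apply: le_trans (hC _ _ _ nn0 Dz).
  exact: lee_abs.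
have xD n (x : {ffun 'I_d -> {set 'I_n}}) : sized (rr n) x -> forall m, D n (k m, x m).
  by move=> /sizedP sx m; exact: sx.
have momb n (nn0 : (n0 <= n)%N) z (Dz : D n z) c : (0 < c <= #|'I_d|)%N ->
    `|fine ('E_P[fun w => (JD n z w ^+ c)%R])%E| <= M.
  by rewrite card_ord; apply: (hM (existT _ n z)).
have mom1 n (nn0 : (n0 <= n)%N) z (Dz : D n z) :
    fine ('E_P[fun w => (JD n z w ^+ 1)%R])%E = 0.
  by under eq_fun do rewrite expr1; rewrite hJ1.
have mom2 n (nn0 : (n0 <= n)%N) z (Dz : D n z) :
    fine ('E_P[fun w => (JD n z w ^+ 2)%R])%E = 1.
  by rewrite hJ2.
(* Letters are read from right to left, as operators act on the vacuum. *)
pose s := rev (enum 'I_d).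
have ps : perm_eq s (enum 'I_d) by rewrite perm_rev.
have rs : rev s = enum 'I_d by rewrite revK.
pose e n (x : {ffun 'I_d -> {set 'I_n}}) : R :=
  fine ('E_P[fun w => (\prod_m JD n (k m, x m) w)%R])%E.
pose W n (x : {ffun 'I_d -> {set 'I_n}}) : R := wick R k x [::] s.
pose c n (x : {ffun 'I_d -> {set 'I_n}}) : R[i] :=
  (normalization R n (rr n))%:C * tr (\prod_(m < d) Psi psi (x m)).
have XE n w : X n w =
    \sum_(x : {ffun 'I_d -> {set 'I_n}} | sized (rr n) x)
      (\prod_m JD n (k m, x m) w)%:C * c n x.
  exact: (trace_prod_syk htr (rr n) (fun m S => J (k m) n S w)).
have main n : (n0 <= n)%N -> complex_integrable P (X n) /\
    complex_expectation P (X n) =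
    \sum_(x : {ffun 'I_d -> {set 'I_n}} | sized (rr n) x) (e n x)%:C * c n x.
  move=> nn0.
  have := @complex_expectation_sum _ _ _ P _ (fun x => sized (rr n) x)
    (fun x w => \prod_m JD n (k m, x m) w) (c n).
  rewrite (_ : X n = fun w => \sum_(x | sized (rr n) x)
     (\prod_m JD n (k m, x m) w)%:C * c n x); last exact/funext/XE.
  apply=> x sx.
  exact: (expectation_monomial (mJ n) (hJind n nn0) (pow n ^~ nn0) (xD n x sx)).1.
split; first by move=> n /main[].
rewrite vacuum_state_pairings -/s.
(* Main term: the sum of the mean signs over the pairings. Error: the families
   with a triple coincidence, weighted by the bound B / sqrt n. *)
pose B : R := (M ^+ #|'I_d| + (size (pairings k [::] s))%:R) * #|{ffun 'I_d -> 'I_d}|%:R.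
apply: (@cvg_real_complex _ _
  (fun n => \sum_(p <- pairings k [::] s) star_mean R r k n p)
  (fun n => B * (Num.sqrt n%:R)^-1)).
- apply: cvg_sum_seq => p pP; apply: (cvg_star_mean hn0 hr hsmall hlambda0 hlambda hq).
  by apply: (pairings_wf _ pP); rewrite /= rev_uniq enum_uniq.
- rewrite -[X in _ --> X](mulr0 B); apply: cvgM; first exact: cvg_cst.
  exact: cvg_inv_sqrtn.
(* Below density 1/2 the number of letters is less than n, as needed for the
   binomial coefficients to be at least n. *)
have half : (0 : R) < 2^-1 by rewrite invr_gt0.
have rhalf : \forall n \near \oo, forall m, (rr n m)%:R / n%:R <= 2^-1 :> R.
  apply: filter_forall => m; move/cvgrPdist_le/(_ _ half) : (hsmall (k m)).
  apply: filterS => n; rewrite sub0r normrN; exact: le_trans (ler_norm _).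
near=> n.
have nn0 : (n0 <= n)%N by near: n; exact: nbhs_infty_ge.
have n_gt0 : (0 < n)%N by exact: leq_trans nn0.
have rn := rrn n nn0.
have small m : (rr n m)%:R / n%:R <= 2^-1 :> R.
  by move: m; near: n.
have binn m : (n%:R : R) <= 'C(n, rr n m)%:R.
  rewrite ler_nat leq_bin //; have /andP[r1 _] := hr (k m) n nn0.
  rewrite r1 /=; move: (small m).
  by rewrite ler_pdivrMr ?ltr0n // mulrC ler_pdivlMr // -natrM ler_nat; lia.
rewrite (main n nn0).2 -(sum_wick_trace car htr rn (krr n) ps rs) -sumrB.
pose Cst : R := M ^+ #|'I_d| + (size (pairings k [::] s))%:R.
have Cst0 : 0 <= Cst by rewrite addr_ge0 // exprn_ge0 // (le_trans ler01).
have norm0 : 0 <= normalization R n (rr n).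
  by apply: prodr_ge0 => m _; rewrite invr_ge0 sqrtr_ge0.
apply: (@le_trans _ _ (\sum_(x : {ffun 'I_d -> {set 'I_n}} | sized (rr n) x)
    (Cst * (coincident k x)%:R * normalization R n (rr n))%:C)).
  apply: (le_trans (ler_norm_sum _ _ _)); apply: ler_sum => x sx.
  rewrite -mulrBl -rmorphB normrM norm_real_complex [X in _ <= X]rmorphM.
  apply: ler_pM => //; first by rewrite ler0c.
    rewrite lecR.
    exact: (expectation_monomial_wick (mJ n) (hJind n nn0) (pow n ^~ nn0) M1
      (momb n nn0) (mom1 n nn0) (mom2 n nn0) (xD n x sx) ps).
  rewrite normrM norm_real_complex (ger0_norm norm0).
  by apply: ler_piMr; [rewrite ler0c | exact: norm_tPsi_le1].
rewrite -rmorph_sum lecR -mulr_suml -mulr_sumr /B -/Cst -!mulrA ler_wpM2l //.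
rewrite mulrC; apply: (coincident_negligible rn (krr n)) => //.
by rewrite ler1n.
Unshelve. all: by end_near. Qed.
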